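(* Let $n\ge2$ and $1<p<n$. There exists a compact set $E\subset\mathbb{R}^n$ such that $$\operatorname{cap}(E;W_p^1)>0\quad\text{and}\quad \operatorname{cap}(E;B_{p,p}^\alpha)=0\ \text{ for every } 0<\alpha<1.$$ Thus (with $q=p$) the equality $$\lim_{\alpha\to 1-0}(1-\alpha)^{p/q}\operatorname{cap}(E;B_{p,q}^\alpha)=\left(\frac1q\right)^{p/q}\operatorname{cap}(E;W_p^1)$$ does not hold for this compact set $E$.
   Context: Here $\|\cdot\|_p$ is the norm of $L^p(\mathbb{R}^n)$, $e_k$ is the $k$th unit coordinate vector, and $D_kf=\partial f/\partial x_k$. For $f\in L^p(\mathbb{R}^n)$, $1\le p<\infty$, the partial modulus of continuity is $$\omega_k(f;\delta)_p=\sup_{0\le h\le\delta}\left(\int_{\mathbb{R}^n}|f(x+he_k)-f(x)|^p\,dx\right)^{1/p}.$$ For $0<\alpha<1$, $1\le p,q<\infty$, $$\|f\|_{b^\alpha_{p,q;k}}=\left(\int_0^\infty\left(t^{-\alpha}\omega_k(f;t)_p\right)^q\frac{dt}{t}\right)^{1/q},\qquad \|f\|_{b^\alpha_{p,q}}=\sum_{k=1}^n\|f\|_{b^\alpha_{p,q;k}}.$$ For a compact set $K\subset\mathbb{R}^n$, let $\mathfrak{N}(K)$ be the set of all $f\in C_0^\infty(\mathbb{R}^n)$ (smooth, compactly supported) such that $f(x)\ge1$ for all $x\in K$. Define $$\operatorname{cap}(K;W_p^1)=\inf\left\{\left(\sum_{k=1}^n\|D_kf\|_p\right)^p: f\in\mathfrak{N}(K)\right\},\qquad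 \operatorname{cap}(K;B_{p,q}^\alpha)=\inf\left\{\|f\|_{b^\alpha_{p,q}}^p: f\in\mathfrak{N}(K)\right\}.$$ *)

(* Defs.v *)
From HB Require Import structures.
From mathcomp Require Import all_boot all_order all_algebra.
From mathcomp Require Import all_classical all_reals all_analysis.

Set Implicit Arguments.
Unset Strict Implicit.
Unset Printing Implicit Defensive.

Import Order.TTheory GRing.Theory Num.Theory.
Import numFieldNormedType.Exports.

Local Open Scope classical_set_scope.
Local Open Scope ring_scope.

Definition measure_rV_display : measure_display -> measure_display.
Proof. exact. Qed.

(* The space R^n is ['rV[R]_n], with its canonical topology and normed module
   structure (the sup norm); we equip it with the product sigma-algebra, i.e.,
   the one generated by the coordinates. *)
Section measurable_rV.
Context {R : realType}.
Variable n : nat.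

Let coor : 'I_n -> 'rV[R]_n -> R := fun i x => x ord0 i.

Let rV_set0 : g_sigma_preimage coor set0.
Proof. exact: sigma_algebra0. Qed.

Let rV_setC A : g_sigma_preimage coor A -> g_sigma_preimage coor (~` A).
Proof. exact: sigma_algebraC. Qed.

Let rV_bigcup (F : _^nat) : (forall i, g_sigma_preimage coor (F i)) ->
  g_sigma_preimage coor (\bigcup_i (F i)).
Proof. exact: sigma_algebra_bigcup. Qed.

HB.instance Definition _ := @isMeasurable.Build
  (measure_rV_display R.-ocitv.-measurable.-sigma)
  'rV[R]_n (g_sigma_preimage coor) rV_set0 rV_setC rV_bigcup.

Lemma measurable_coord (i : 'I_n) :
  measurable_fun [set: 'rV[R]_n] (fun x : 'rV[R]_n => x ord0 i).
Proof.
move=> _ Y mY; rewrite setTI; apply: sub_sigma_algebra => /=.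
rewrite -bigcup_seq/=; exists i => /=; first by rewrite mem_index_enum.
by exists Y => //; rewrite setTI.
Qed.

Lemma measurable_fun_rVP d (T : measurableType d) (f : T -> 'rV[R]_n) :
  (forall i, measurable_fun [set: T] (fun x => f x ord0 i)) ->
  measurable_fun [set: T] f.
Proof.
move=> mf; have prefS : g_sigma_preimage (fun i => coor i \o f) `<=` measurable.
  apply: smallest_sub; first exact: sigma_algebra_measurable.
  rewrite -bigcup_seq; apply: bigcup_sub => i _.
  by move=> A [B mB <-]; exact: mf.
move=> _ A mA; apply: prefS.
by rewrite g_sigma_preimage_comp; exists A.
Qed.

End measurable_rV.

Section cons_rV.
Context {R : realType}.

Definition cons_rV n (z : R * 'rV[R]_n) : 'rV[R]_n.+1 :=
  row_mx (const_mx z.1 : 'rV_1) z.2.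

Definition uncons_rV n (x : 'rV[R]_n.+1) : R * 'rV[R]_n :=
  (x ord0 ord0, \row_i x ord0 (lift ord0 i)).

Lemma cons_rV0 n (z : R * 'rV[R]_n) : cons_rV z ord0 ord0 = z.1.
Proof.
have -> : ord0 = lshift n (ord0 : 'I_1) :> 'I_(1 + n) by exact/val_inj.
by apply: etrans (row_mxEl _ _ _ _) _; rewrite mxE.
Qed.

Lemma cons_rVS n (z : R * 'rV[R]_n) (i : 'I_n) :
  cons_rV z ord0 (lift ord0 i) = z.2 ord0 i.
Proof.
have -> : lift ord0 i = rshift 1 i :> 'I_(1 + n) by exact/val_inj.
exact: row_mxEr.
Qed.

Lemma cons_rVK n : cancel (@cons_rV n) (@uncons_rV n).
Proof.
move=> [a x]; rewrite /uncons_rV cons_rV0; congr pair.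
by apply/rowP => i; rewrite mxE cons_rVS.
Qed.

Lemma uncons_rVK n : cancel (@uncons_rV n) (@cons_rV n).
Proof.
move=> x; apply/rowP => i; case: (unliftP ord0 i) => [j ->|->].
  by rewrite cons_rVS mxE.
by rewrite cons_rV0.
Qed.

Lemma measurable_cons_rV n : measurable_fun [set: R * 'rV[R]_n] (@cons_rV n).
Proof.
apply: measurable_fun_rVP => i; case: (unliftP ord0 i) => [j ->|->].
  under eq_fun do rewrite cons_rVS.
  exact: (measurableT_comp (measurable_coord j) measurable_snd).
by under eq_fun do rewrite cons_rV0; exact: measurable_fst.
Qed.

Lemma measurable_uncons_rV n :
  measurable_fun [set: 'rV[R]_n.+1] (@uncons_rV n).
Proof.
apply: measurable_fun_pair; first exact: measurable_coord.
apply: measurable_fun_rVP => i; under eq_fun do rewrite mxE.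
exact: measurable_coord.
Qed.

End cons_rV.

Section lebesgue_rV_succ.
Context {R : realType}.
Variable n : nat.
Variable mu : {sigma_finite_measure set 'rV[R]_n -> \bar R}.

Definition lebesgue_rV_succ : set 'rV[R]_n.+1 -> \bar R :=
  pushforward (@lebesgue_measure R \x mu)%E (@cons_rV R n).

Let succ0 : lebesgue_rV_succ set0 = 0%E.
Proof. by rewrite /lebesgue_rV_succ /pushforward preimage_set0 measure0. Qed.

Let succ_ge0 A : (0 <= lebesgue_rV_succ A)%E.
Proof. by rewrite /lebesgue_rV_succ /pushforward measure_ge0. Qed.

Let succ_sigma_additive : semi_sigma_additive lebesgue_rV_succ.
Proof.
move=> F mF tF mUF; rewrite /lebesgue_rV_succ /pushforward preimage_bigcup.
have mf A : measurable A -> measurable (@cons_rV R n @^-1` A).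
  by move=> mA; rewrite -[X in measurable X]setTI; exact: measurable_cons_rV.
apply: measure_semi_sigma_additive.
- by move=> k; exact: mf.
- apply/trivIsetP => /= i j _ _ ij; rewrite -preimage_setI.
  by move/trivIsetP : tF => /(_ _ _ _ _ ij) ->//; rewrite preimage_set0.
- by rewrite -preimage_bigcup; exact: mf.
Qed.

HB.instance Definition _ := isMeasure.Build _ _ _ lebesgue_rV_succ
  succ0 succ_ge0 succ_sigma_additive.

(* The canonical sigma-finiteness of [m1 \x m2] is shadowed by the instance for
   subprobabilities, hence the direct proof. *)
Let succ_sigma_finite : sigma_finite setT lebesgue_rV_succ.
Proof.
have /sigma_finiteP[F [TF ndF Foo]] := sigma_finiteT (@lebesgue_measure R).
have /sigma_finiteP[G [TG ndG Goo]] := sigma_finiteT mu.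
exists (fun k => @uncons_rV R n @^-1` (F k `*` G k)).
  rewrite -preimage_bigcup (_ : \bigcup_k _ = setT) ?preimage_setT//.
  rewrite -subTset => -[x y] _.
  have [i _ Fx] : (\bigcup_i F i) x by rewrite -TF.
  have [j _ Gy] : (\bigcup_j G j) y by rewrite -TG.
  exists (maxn i j) => //; split.
    by move: x Fx; exact/subsetPset/ndF/leq_maxl.
  by move: y Gy; exact/subsetPset/ndG/leq_maxr.
move=> k; have [mFk Fkoo] := Foo k; have [mGk Gkoo] := Goo k; split.
  rewrite -[X in measurable X]setTI.
  by apply: measurable_uncons_rV => //; exact: measurableX.
rewrite /lebesgue_rV_succ /pushforward -comp_preimage.
rewrite (_ : _ \o _ = id) ?preimage_id; last exact/funext/cons_rVK.
by rewrite product_measure1E// lte_mul_pinfty// ge0_fin_numE.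
Qed.

HB.instance Definition _ := Measure_isSigmaFinite.Build _ _ _ lebesgue_rV_succ
  succ_sigma_finite.

End lebesgue_rV_succ.

(* Lebesgue measure on the Borel sets of R^n: the unit mass at the only point
   of R^0, and then, inductively, the product of [lebesgue_measure] with
   [lebesgue_rV n]. *)
Fixpoint lebesgue_rV {R : realType} (n : nat) :
    {sigma_finite_measure set 'rV[R]_n -> \bar R} :=
  match n with
  | 0 => @dirac _ 'rV[R]_0 0 R
  | m.+1 => lebesgue_rV_succ (lebesgue_rV m)
  end.

Lemma lebesgue_rV_box {R : realType} n (A : 'I_n -> set R) :
  (forall i, measurable (A i)) ->
  lebesgue_rV n [set x : 'rV[R]_n | forall i, A i (x ord0 i)] =
  (\prod_(i < n) lebesgue_measure (A i))%E.
Proof.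
elim: n A => [|n IHn] A mA.
  by rewrite big_ord0 /= diracE mem_set// => -[].
rewrite big_ord_recl -IHn; last by move=> i; exact: mA.
rewrite -product_measure1E; [| exact: mA|]; last first.
  rewrite (_ : [set _ | _] =
      \bigcap_(i in [set: 'I_n]) ((fun x : 'rV[R]_n => x ord0 i) @^-1`
        A (lift ord0 i))); last first.
    by apply/seteqP; split => x /= Ax; [move=> i _; exact: Ax|
      move=> i; exact: Ax].
  apply: fin_bigcap_measurable => // i _.
  by rewrite -[X in measurable X]setTI; exact: measurable_coord.
rewrite /= /lebesgue_rV_succ /pushforward; congr (product_measure1 _ _ _).
apply/seteqP; split => z /= Az.
  split; first by have := Az ord0; rewrite cons_rV0.
  by move=> i; have := Az (lift ord0 i); rewrite cons_rVS.
by move=> i; case: (unliftP ord0 i) => [j ->|->];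
  rewrite ?cons_rVS ?cons_rV0; [exact: Az.2|exact: Az.1].
Qed.

Section capacity.
Context {R : realType} {n : nat}.
Implicit Types (f : 'rV[R]_n -> R) (K : set 'rV[R]_n) (p q alpha : R).

Definition unit_vec (k : 'I_n) : 'rV[R]_n := delta_mx 0 k.

Definition partial (k : 'I_n) f : 'rV[R]_n -> R := 'D_(unit_vec k) f.

(* [f] is C^oo: the iterated partial derivatives of all orders, in any order of
   differentiation, exist and are continuous. *)
Definition smooth f := forall s : seq 'I_n,
  continuous (foldr partial f s) /\
  forall k x, derivable (foldr partial f s) x (unit_vec k).

Definition compactly_supported f := compact (closure [set x | f x != 0]).

Definition admissible K : set ('rV[R]_n -> R) :=
  [set f | [/\ smooth f, compactly_supported f & forall x, K x -> 1 <= f x]].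

Local Open Scope ereal_scope.

(* [Lnorm] takes its values in [\bar R], and hence so do the modulus of
   continuity, the Besov norms and the capacities below. *)
Definition partial_modulus (k : 'I_n) p f (delta : R) : \bar R :=
  ereal_sup
    [set 'N[lebesgue_rV n]_p%:E[EFin \o (fun x => f (x + h *: unit_vec k) - f x)%R] |
      h in `[0%R, delta]].

Definition besov_partial_norm alpha p q (k : 'I_n) f : \bar R :=
  (\int[lebesgue_measure]_(t in `]0%R, +oo[)
     (((t `^ (- alpha))%:E * partial_modulus k p f t) `^ q * (t^-1)%:E)) `^ q^-1.

Definition besov_norm alpha p q f : \bar R :=
  \sum_(k < n) besov_partial_norm alpha p q k f.

Definition cap_sobolev p K : \bar R :=
  ereal_inf [set (\sum_(k < n) 'N[lebesgue_rV n]_p%:E[EFin \o partial k f]) `^ p |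
             f in admissible K].

Definition cap_besov alpha p q K : \bar R :=
  ereal_inf [set besov_norm alpha p q f `^ p | f in admissible K].

End capacity.

(* Main.v *)
From HB Require Import structures.
Require Import Defs.
From mathcomp Require Import all_boot all_order all_algebra.
From mathcomp Require Import all_classical all_reals all_analysis.
From mathcomp Require Import measurable_realfun.
From mathcomp Require Import ring lra zify.

Import Order.TTheory GRing.Theory Num.Theory.
Import numFieldNormedType.Exports.

Local Open Scope classical_set_scope.
Local Open Scope ring_scope.
Set Implicit Arguments.
Unset Strict Implicit.
Unset Printing Implicit Defensive.

(** The compact set is the closure of a product of [n] copies of a Cantor set of
    [0, 1), of critical dimension: its points are the reals some binary digits
    of which are forced to be [0], the same ones in each coordinate. Let [b i] be
    the number of forced digits among the [i] first ones, so that the Cantor set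
    [C_i] of rank [i], a union of dyadic intervals of length [2 ^- i], has
    measure [2 ^- b i], and put [x_i = 2 ^ (n / p * b i) / 2 ^ i]. The digits are
    chosen greedily ([greedy]) in such a way that the sum of the [x_i] over the
    forced digits converges ([sum_greedy_le]), whereas [x_i] is bounded below by
    the inverse of a quadratic polynomial in [i] ([greedy_ge]); this is possible
    because [n / p > 1].

    The Sobolev capacity is positive ([cap_sobolev_gt0]). If a set [B] is the
    disjoint union of [A] and of its translate by [h e_k], the average of [`|f|]
    over [A] exceeds the one over [B] by at most
    [h * |A| ^ (- 1 / p) * ||D_k f||_p]: this follows from Hölder's inequality and
    from [||f (x + h e_k) - f x||_p <= h ||D_k f||_p] ([Lnorm_diff_le],
    [average_step]). Releasing the last forced digit, of rank [i], in each
    coordinate successively, the passage from the power of [C_i] to the one of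
    [C_(i - 1)] costs [x_i] times the gradient norm ([cube_average_step],
    [cantor_av_le]). From [0, 1)^n on, one proceeds in the same way with the cubes
    [0, 2 ^ j)^n, at a cost that is the term of a convergent geometric series
    ([itv_av_le]). As the average of a compactly supported function over large
    cubes tends to [0], while it is at least [1 / 2] over the Cantor sets of large
    rank if [f >= 1] on the compact set, the gradient norm is bounded below
    ([gradient_norm_ge]).

    The Besov capacities vanish ([cap_besov_eq0]). A sum of rescaled smooth bumps
    gives a function of one variable that is at least [1] on [C_i] and lives in
    its neighborhood of width [2 ^- i]; the product of its values at the [n]
    coordinates is a test function [f] with
    [||f||_p ^ p <= A * 2 ^ (- n * b i)] and
    [||D_k f||_p ^ p <= A * 2 ^ (- n * b i) * 2 ^ (i * p)]
    ([cantor_test_function]). As the modulus of continuity is at most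
    [t * ||D_k f||_p] and at most [2 * ||f||_p], the Besov norm to the power [p] is
    at most a constant times [2 ^ (- n * b i) * 2 ^ (i * alpha * p)]
    ([besov_partial_norm_le]), that is, [(2 ^ (i * (alpha - 1)) / x_i) ^ p], and
    this tends to [0] because [alpha < 1].

    Finally, the left-hand side of the limit relation vanishes for [alpha] in
    (0, 1), whereas its right-hand side is positive. *)

(** * Measure theory on R^n *)

Section integral_ge0.
Local Open Scope ereal_scope.
Context d (T : measurableType d) (R : realType).
Variable mu : {measure set T -> \bar R}.

(** Monotonicity of the integral of nonnegative functions needs no
    measurability: the integral is a supremum over the simple functions below
    the integrand. *)
Lemma ge0_le_integral_nomeas (D : set T) (f g : T -> \bar R) :
  (forall x, D x -> 0 <= f x) -> (forall x, D x -> f x <= g x) ->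
  \int[mu]_(x in D) f x <= \int[mu]_(x in D) g x.
Proof.
move=> f0 fg.
have g0 x : D x -> 0 <= g x by move=> Dx; exact: le_trans (f0 x Dx) (fg x Dx).
rewrite !ge0_integralE//; apply: le_ereal_sup => _ [h hf <-]; exists h => //.
move=> x; apply: (le_trans (hf x)); rewrite /patch; case: ifPn => // xD.
by apply: fg; rewrite -in_setE.
Qed.

End integral_ge0.

Section translation.
Context {R : realType}.

Lemma measurable_translation_rV n (a : 'rV[R]_n) :
  measurable_fun [set: 'rV[R]_n] (fun x => x + a).
Proof.
apply: measurable_fun_rVP => i; under eq_fun do rewrite mxE.
exact: measurable_funD (measurable_coord i) (measurable_cst _).
Qed.

Lemma measurable_translation_set_rV n (a : 'rV[R]_n) (A : set 'rV[R]_n) :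
  measurable A -> measurable [set x | A (x + a)].
Proof.
move=> mA; have := @measurable_translation_rV n a measurableT _ mA.
by rewrite setTI.
Qed.

Lemma lebesgue_measure_translation (c : R) (A : set R) : measurable A ->
  lebesgue_measure [set x | A (x + c)] = lebesgue_measure A.
Proof.
move=> mA; pose tr : R -> measurableTypeR R := fun x => x + c.
have mtr : measurable_fun [set: measurableTypeR R] tr.
  by apply: measurable_funD => //; exact: measurable_cst.
suff H : forall X, ocitv X ->
    lebesgue_measure X = pushforward lebesgue_measure tr X.
  exact/esym/(@lebesgue_measure_unique R _ H A mA).
move=> _ [[a b]] _ <-; rewrite /pushforward /=.
have -> : tr @^-1` `]a, b] = `]a - c, b - c]%classic.
  by apply/seteqP; split=> x; rewrite /tr /= !in_itv/= ltrBlDr lerBrDr.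
by rewrite !lebesgue_measure_itv/= !lte_fin ltrD2r -!EFinD opprB addrA subrK.
Qed.

Lemma ge0_integral_translation (c : R) (f : R -> \bar R) :
  measurable_fun [set: R] f -> (forall x, 0 <= f x)%E ->
  (\int[lebesgue_measure]_x f (x + c)%R = \int[lebesgue_measure]_x f x)%E.
Proof.
move=> mf f0.
have mtr : measurable_fun [set: measurableTypeR R]
    (fun x => x + c : measurableTypeR R).
  by apply: measurable_funD => //; exact: measurable_cst.
have := @ge0_integral_pushforward _ _ _ _ R _ mtr lebesgue_measure setT f
  measurableT mf (fun x _ => f0 x).
rewrite preimage_setT => <-; apply: eq_measure_integral => A mA _.
by rewrite /pushforward; exact: lebesgue_measure_translation.
Qed.

Lemma lebesgue_rV_translation n (a : 'rV[R]_n) (A : set 'rV[R]_n) :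
  measurable A ->
  lebesgue_rV n [set x : 'rV[R]_n | A (x + a)] = lebesgue_rV n A.
Proof.
elim: n a A => [|n IHn] a A mA.
  congr (_ _); apply/seteqP; split => x /=; rewrite (thinmx0 (x + a));
  by rewrite (thinmx0 x).
pose B := @cons_rV R n @^-1` A.
have mB : measurable B.
  by rewrite -[X in measurable X]setTI; exact: measurable_cons_rV.
pose phi x := lebesgue_rV n (xsection B x).
have mphi : measurable_fun setT phi by exact: measurable_fun_xsection.
have -> : lebesgue_rV n.+1 A = (\int[lebesgue_measure]_x phi x)%E by [].
rewrite -(@ge0_integral_translation (a ord0 ord0))//.
apply: eq_integral => x _; rewrite /= /phi -(IHn (uncons_rV a).2); last first.
  exact: measurable_xsection.
congr (lebesgue_rV n _); apply/seteqP; split => y; rewrite /xsection/= !inE/=.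
  move=> Axy; rewrite /B/=; suff <- : cons_rV (x, y) + a =
    cons_rV (x + a ord0 ord0, y + (uncons_rV a).2) by [].
  by apply/rowP => i; case: (unliftP ord0 i) => [j ->|->];
    rewrite mxE ?cons_rV0 ?cons_rVS/= ?mxE.
rewrite /B/=; suff -> : cons_rV (x, y) + a =
    cons_rV (x + a ord0 ord0, y + (uncons_rV a).2) by [].
by apply/rowP => i; case: (unliftP ord0 i) => [j ->|->];
  rewrite mxE ?cons_rV0 ?cons_rVS/= ?mxE.
Qed.

Lemma ge0_integral_translation_rV n (a : 'rV[R]_n) (D : set 'rV[R]_n)
    (f : 'rV[R]_n -> \bar R) :
  measurable D -> measurable_fun [set: 'rV[R]_n] f -> (forall x, 0 <= f x)%E ->
  (\int[lebesgue_rV n]_(x in [set x | D (x + a)%R]) f (x + a)%R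
   = \int[lebesgue_rV n]_(x in D) f x)%E.
Proof.
move=> mD mf f0.
rewrite -(@ge0_integral_pushforward _ _ _ _ R _ (measurable_translation_rV a)
  (lebesgue_rV n) D f)//; last exact: measurable_funTS.
apply: eq_measure_integral; first exact: measurable_translation_rV.
by move=> m A mA _; exact: lebesgue_rV_translation.
Qed.

(** The open cubes of rational center and radius [1 / (m + 1)], with [m] in [nat],
    are a countable base of the topology, so the open sets
    belong to the sigma-algebra generated by the coordinates. *)
Lemma open_measurable_rV n (U : set 'rV[R]_n) : open U -> measurable U.
Proof.
move=> oU.
pose box (z : 'rV[rat]_n * nat) : set 'rV[R]_n :=
  [set x | forall i, `|x ord0 i - ratr (z.1 ord0 i)| < z.2.+1%:R^-1].
have mbox z : measurable (box z).
  rewrite (_ : box z = \bigcap_(i in [set: 'I_n]) ((fun x : 'rV[R]_n =>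
      `|x ord0 i - ratr (z.1 ord0 i)|) @^-1` `]-oo, z.2.+1%:R^-1[)); last first.
    by apply/seteqP; split=> x bx i; [move=> _ /=; rewrite in_itv; exact: bx|
      have := bx i Logic.I; rewrite /= in_itv].
  apply: fin_bigcap_measurable => // i _; rewrite -[X in measurable X]setTI.
  have mf : measurable_fun setT (fun x : 'rV[R]_n =>
      `|x ord0 i - ratr (z.1 ord0 i)|).
    apply: measurableT_comp => //; apply: measurable_funB.
      exact: measurable_coord.
    exact: measurable_cst.
  exact: mf.
pose F k := if unpickle k is Some z then
  (if `[< box z `<=` U >] then box z else set0) else set0.
suff -> : U = \bigcup_k F k.
  apply: bigcupT_measurable => k; rewrite /F; case: unpickle => // z.
  by case: ifP.
apply/seteqP; split=> [x Ux|x [k _]]; last first.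
  by rewrite /F; case: unpickle => // z; case: ifPn => // /asboolP; exact.
have /nbhs_ballP[e /= e0 xeU] : nbhs x U by exact: open_nbhs_nbhs.
have [m me] : exists m : nat, m.+1%:R^-1 < e / 2.
  exists (Num.truncn (e / 2)^-1); rewrite invf_plt ?posrE ?divr_gt0//.
  exact: truncnS_gt.
have m0 : (0 : R) < m.+1%:R^-1 by rewrite invr_gt0.
have qP i : {q : rat | `|x ord0 i - ratr q| < m.+1%:R^-1}.
  apply/cid; have [|q] := @rat_in_itvoo R (x ord0 i - m.+1%:R^-1) (x ord0 i).
    by rewrite ltrBlDr ltrDl.
  rewrite in_itv/= => /andP[xq qx]; exists q.
  by rewrite ger0_norm ?subr_ge0 ?(ltW qx)// ltrBlDr addrC -ltrBlDr.
pose q := \row_i sval (qP i); exists (pickle (q, m)) => //.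
have bx : box (q, m) x by move=> i; rewrite mxE; case: (qP i).
rewrite /F pickleK ifT//; apply/asboolP => y yb; apply: xeU; split => // i j.
rewrite (ord1 i) /ball/= -(subrKA (ratr (q ord0 j)))/=.
rewrite (le_lt_trans (ler_normD _ _))// [ltRHS]splitr ltrD//.
  exact: lt_trans (bx j) _.
by rewrite distrC; exact: lt_trans (yb j) _.
Qed.

Lemma continuous_measurable_rV n (f : 'rV[R]_n -> R) :
  continuous f -> measurable_fun [set: 'rV[R]_n] f.
Proof.
move=> cf; apply: (measurability _ (RGenOpens.measurableE R)).
move=> _ [_ [a [b ->] <-]]; rewrite setTI; apply: open_measurable_rV.
by apply: open_comp => // x _; exact: cf.
Qed.

End translation.

(** * The difference quotient inequality *)

Lemma le_poweR (R : realType) (r : R) (x y : \bar R) :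
  0 <= r -> (0 <= x)%E -> (x <= y)%E -> (x `^ r <= y `^ r)%E.
Proof.
move=> r0 x0 xy; apply: gt0_ler_poweR => //; rewrite in_itv/= leey andbT//.
exact: le_trans xy.
Qed.

Section holder_set.
Local Open Scope ereal_scope.
Context d (T : measurableType d) (R : realType).
Variable mu : {measure set T -> \bar R}.

Lemma holder_set (p : R) (A : set T) (F : T -> R) :
  (1 < p)%R -> measurable A -> measurable_fun setT F ->
  \int[mu]_(x in A) `|(F x)%:E| <= 'N[mu]_p%:E[EFin \o F] * mu A `^ (1 - p^-1).
Proof.
move=> p1 mA mF; have p0 : (0 < p)%R by exact: lt_trans p1.
have q0 : (0 < 1 - p^-1)%R by rewrite subr_gt0 invf_lt1.
have mI : measurable_fun setT (\1_A : T -> R) by exact: measurable_indic.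
have := @hoelder _ _ _ mu F \1_A p (1 - p^-1)^-1 mF mI p0.
rewrite invr_gt0 invrK (addrC p^-1%R) subrK => /(_ q0 erefl).
have -> : 'N[mu]_((1 - p^-1)^-1%R)%:E[EFin \o \1_A] = mu A `^ (1 - p^-1).
  rewrite unlock invrK; congr (_ `^ _).
  rewrite -[in RHS](setIT A) -integral_indic//; apply: eq_integral => x _.
  rewrite /= indicE; case: (x \in A); rewrite /= ?normr1 ?powR1//.
  by rewrite normr0 powR0// invr_neq0// gt_eqF.
rewrite Lnorm1.
apply: le_trans; rewrite le_eqVlt; apply/orP; left; apply/eqP.
rewrite integral_mkcond; apply: eq_integral => x _.
by rewrite patchE /= indicE; case: ifPn => _; rewrite ?mulr1// mulr0 normr0.
Qed.

Lemma holder_set_powR (p : R) (A : set T) (F : T -> R) :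
  (1 < p)%R -> measurable A -> measurable_fun setT F ->
  (\int[mu]_(x in A) `|(F x)%:E|) `^ p <=
  mu A `^ (p - 1) * \int[mu]_(x in A) `|(F x)%:E| `^ p.
Proof.
move=> p1 mA mF; have p0 : (0 < p)%R by exact: lt_trans p1.
have pN0 : p != 0%R by rewrite gt_eqF.
pose G : T -> R := (F \* \1_A)%R.
have mG : measurable_fun setT G.
  by apply: measurable_funM => //; exact: measurable_indic.
have GE (x : T) : G x = if x \in A then F x else 0%R.
  by rewrite /G/= indicE; case: ifPn => _; rewrite ?mulr1 ?mulr0.
have -> : \int[mu]_(x in A) `|(F x)%:E| = \int[mu]_(x in A) `|(G x)%:E|.
  by apply: eq_integral => x xA; rewrite GE xA.
have -> : \int[mu]_(x in A) `|(F x)%:E| `^ p = 'N[mu]_p%:E[EFin \o G] `^ p.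
  rewrite (@poweR_Lnorm _ _ _ mu (EFin \o G) p pN0) integral_mkcond.
  apply: eq_integral => x _.
  rewrite patchE /= GE; case: ifPn => // _.
  by rewrite normr0 powR0// gt_eqF.
apply: (le_trans (le_poweR (ltW p0) _ (holder_set p1 mA mG))).
  by apply: integral_ge0 => x _; exact: abse_ge0.
rewrite poweRM ?Lnorm_ge0 ?poweR_ge0// -poweRrM mulrBl mul1r mulVf ?gt_eqF//.
by rewrite muleC.
Qed.

End holder_set.

Section difference_quotient.
Context {R : realType} {n : nat}.
Implicit Types (f : 'rV[R]_n -> R) (k : 'I_n).

(** The restriction of [f] to the line through [x] parallel to the [k]th axis. *)
Let line f k (x : 'rV[R]_n) (s : R) : R := f (x + s *: unit_vec k).

Lemma is_derive_line f k x s : derivable f (x + s *: unit_vec k) (unit_vec k) ->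
  is_derive s 1 (line f k x) (partial k f (x + s *: unit_vec k)).
Proof.
move=> df.
have E : (fun h => h^-1 *: ((line f k x \o shift s) (h *: 1) - line f k x s)) =
  (fun h => h^-1 *: ((f \o shift (x + s *: unit_vec k)) (h *: unit_vec k)
    - f (x + s *: unit_vec k))).
  apply/funext => h; rewrite /line/= /shift/=; congr (_ *: (f _ - _)).
  by rewrite scaler1 scalerDl addrCA.
split; first by rewrite /derivable E.
by rewrite /derive E.
Qed.

Lemma continuous_line f k x : continuous f -> continuous (line f k x).
Proof.
move=> cf s.
have cl : {for s, continuous (fun s : R => x + s *: unit_vec k : 'rV[R]_n)}.
  apply: cvgD; first exact: cvg_cst.
  by apply: cvgZr_tmp; exact: cvg_id.
exact: (continuous_comp cl (cf _)).
Qed.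

Lemma diff_le_integral_partial f k x h : 0 <= h ->
  continuous f -> (forall y, derivable f y (unit_vec k)) ->
  continuous (partial k f) ->
  (`|(f (x + h *: unit_vec k) - f x)%R%:E| <=
   \int[lebesgue_measure]_(s in `[0%R, h])
     `|(partial k f (x + s *: unit_vec k)%R)%:E|)%E.
Proof.
move=> h0 cf df cDf.
case: (eqVneq h 0) => [->|hN0].
  by rewrite scale0r addr0 subrr/= normr0; apply: integral_ge0.
have {h0 hN0} h0 : 0 < h by rewrite lt0r hN0.
have := @continuous_FTC2 R (line (partial k f) k x) (line f k x) 0 h h0.
have -> : line f k x 0 = f x by rewrite /line scale0r addr0.
rewrite EFinB => <-; last 3 first.
- by apply: continuous_subspaceT; exact: continuous_line.
- split=> [s _||]; first by case: (is_derive_line (df (x + s *: unit_vec k))).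
    by apply: cvg_at_right_filter; exact: continuous_line.
  by apply: cvg_at_left_filter; exact: continuous_line.
- move=> s _; rewrite derive1E.
  by case: (is_derive_line (df (x + s *: unit_vec k))).
apply: le_abse_integral => //; apply/measurable_EFinP.
apply: measurable_funTS; apply: continuous_measurable_fun.
exact: continuous_line.
Qed.

(** [f (x + h e_k) - f x] is the integral of the partial derivative along a
    segment of length [h]: apply Hölder's inequality on that segment, integrate
    in [x], exchange the integrals and use the invariance by translation. *)
Lemma Lnorm_diff_le (p : R) f k h : 1 < p -> 0 <= h ->
  continuous f -> (forall y, derivable f y (unit_vec k)) ->
  continuous (partial k f) ->
  ('N[lebesgue_rV n]_p%:E[EFin \o (fun x => f (x + h *: unit_vec k) - f x)%R]
   <= h%:E * 'N[lebesgue_rV n]_p%:E[EFin \o partial k f])%E.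
Proof.
move=> p1 h0 cf df cDf; have p0 : 0 < p by exact: lt_trans p1.
have pN0 : p != 0 by rewrite gt_eqF.
pose D := partial k f; pose e := unit_vec k : 'rV[R]_n.
pose g (z : 'rV[R]_n * R) : \bar R :=
  (`|D (z.1 + z.2 *: e)| `^ p * \1_`[0%R, h] z.2)%:E.
have mD : measurable_fun [set: 'rV[R]_n] D by exact: continuous_measurable_rV.
have mshift : measurable_fun [set: 'rV[R]_n * R] (fun z => z.1 + z.2 *: e).
  apply: measurable_fun_rVP => i; under eq_fun do rewrite !mxE.
  apply: measurable_funD.
    exact: (measurableT_comp (measurable_coord i) measurable_fst).
  by apply: measurable_funM; [exact: measurable_snd|exact: measurable_cst].
have mg : measurable_fun setT g.
  apply/measurable_EFinP; apply: measurable_funM.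
    apply: (measurableT_comp (@measurable_powR R p)); apply: measurableT_comp => //.
    exact: (measurableT_comp mD mshift).
  apply: (measurableT_comp _ measurable_snd).
  exact: measurable_indic.
have g0 z : (0 <= g z)%E.
  by rewrite lee_fin mulr_ge0 ?powR_ge0// indicE; case: (_ \in _).
have gE (x : 'rV[R]_n) : (\int[lebesgue_measure]_(s in `[0%R, h])
    `|(D (x + s *: e)%R)%:E| `^ p = \int[lebesgue_measure]_s g (x, s))%E.
  rewrite integral_mkcond; apply: eq_integral => s _; rewrite patchE /g/= indicE.
  by case: ifPn => _; rewrite ?mulr1// mulr0.
have muIE : lebesgue_measure `[0%R, h]%classic = h%:E :> \bar R.
  rewrite lebesgue_measure_itv/= lte_fin oppr0 adde0; case: ifPn => // h0'.
  by congr EFin; apply/eqP; rewrite eq_le h0 leNgt h0'.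
have Dp : (\int[lebesgue_rV n]_x `|(f (x + h *: e) - f x)%R%:E| `^ p <=
    (h `^ p)%:E * \int[lebesgue_rV n]_x `|(D x)%:E| `^ p)%E.
  apply: (@le_trans _ _
      (\int[lebesgue_rV n]_x ((h `^ (p - 1))%:E *
        \int[lebesgue_measure]_s g (x, s)))%E).
    apply: ge0_le_integral_nomeas => x _; first exact: poweR_ge0.
    have mDx : measurable_fun [set: R] (fun s => D (x + s *: e)).
      by apply: continuous_measurable_fun; exact: continuous_line.
    have := le_poweR (ltW p0) (abse_ge0 _)
      (diff_le_integral_partial x h0 cf df cDf).
    move=> /le_trans; apply; rewrite -gE.
    have := @holder_set_powR _ _ _ lebesgue_measure p `[0, h]%classic
      _ p1 (measurable_itv _) mDx.
    move=> /le_trans; apply.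
    by rewrite (_ : (_ `^ (p - 1) = (h `^ (p - 1))%:E)%E)// -poweR_EFin -muIE.
  have Fm := @measurable_fun_fubini_tonelli_F _ _ _ _ _ lebesgue_measure g mg g0.
  rewrite ge0_integralZl ?lee_fin ?powR_ge0//; last first.
    by move=> x _; exact: integral_ge0.
  rewrite (@fubini_tonelli _ _ _ _ _ (lebesgue_rV n) lebesgue_measure g mg g0).
  have -> : (\int[lebesgue_measure]_s \int[lebesgue_rV n]_x g (x, s) =
      \int[lebesgue_measure]_(s in `[0%R, h])
        \int[lebesgue_rV n]_x `|(D x)%:E| `^ p)%E.
    rewrite [RHS]integral_mkcond; apply: eq_integral => s _.
    rewrite patchE /g/= indicE; case: ifPn => _; last first.
      by rewrite integral0_eq// => x _; rewrite mulr0.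
    under eq_integral do rewrite mulr1.
    have mDp : measurable_fun setT (fun x => (`|D x| `^ p)%:E).
      apply/measurable_EFinP; apply: (measurableT_comp (@measurable_powR R p)).
      exact: measurableT_comp.
    have Dp0 x : (0 <= (`|D x| `^ p)%:E)%E by rewrite lee_fin powR_ge0.
    exact: (ge0_integral_translation_rV (s *: e) measurableT mDp Dp0).
  set C := (\int[lebesgue_rV n]_x `|(D x)%:E| `^ p)%E.
  have -> : (\int[lebesgue_measure]_(s in `[0%R, h]) C = C * h%:E)%E.
    by rewrite integral_cst//; congr (_ * _)%E.
  by rewrite [X in (_ * X)%E]muleC muleA -EFinM mulrC mulr_powRB1.
rewrite unlock.
apply: (le_trans (le_poweR _ _ Dp)); first by rewrite invr_ge0 ltW.
  by apply: integral_ge0 => x _; exact: poweR_ge0.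
rewrite poweRM ?lee_fin ?powR_ge0//; last first.
  by apply: integral_ge0 => x _; exact: poweR_ge0.
by rewrite poweR_EFin -powRrM mulfV// powRr1.
Qed.

End difference_quotient.

(** * Averages over cubes *)

Section averages.
Context {R : realType} {n : nat}.
Implicit Types (f : 'rV[R]_n -> R) (k : 'I_n) (A B : set 'rV[R]_n).

Lemma smooth_continuous f : smooth f -> continuous f.
Proof. by move=> /(_ [::]) []. Qed.

Lemma smooth_derivable f k x : smooth f -> derivable f x (unit_vec k).
Proof. by move=> /(_ [::]) [_]; exact. Qed.

Lemma smooth_partial_continuous f k : smooth f -> continuous (partial k f).
Proof. by move=> /(_ [:: k]) []. Qed.

(** [B] is the disjoint union of [A] and of its translate by [h e_k], so that
    the integral of [`|f|] over [B] is at least twice the one over [A], up to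
    the integral over [A] of the difference [f (x + h e_k) - f x]. *)
Lemma average_step (p h m : R) f k A B :
  1 < p -> 0 <= h -> 0 < m -> smooth f ->
  measurable A -> measurable B -> lebesgue_rV n A = m%:E ->
  B = A `|` [set x | A (x - h *: unit_vec k)] ->
  A `&` [set x | A (x - h *: unit_vec k)] = set0 ->
  (m^-1%:E * \int[lebesgue_rV n]_(x in A) `|(f x)%:E| <=
   (2 * m)^-1%:E * \int[lebesgue_rV n]_(x in B) `|(f x)%:E| +
   (h * m `^ (- p^-1))%:E * 'N[lebesgue_rV n]_p%:E[EFin \o partial k f])%E.
Proof.
move=> p1 h0 m0 sf mA mB Am BE AI.
have mf : measurable_fun setT f.
  by apply: continuous_measurable_rV; exact: smooth_continuous.
have mabs (F : 'rV[R]_n -> R) : measurable_fun setT F ->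
    measurable_fun [set: 'rV[R]_n] (fun x => `|(F x)%:E|)%E.
  by move=> mF; apply/measurable_EFinP; exact: measurableT_comp.
have mnf := mabs _ mf.
set e := h *: unit_vec k; set N := ('N[_]_ _[_])%E.
set S := [set x | A (x - e)] in BE AI.
have mS : measurable S by exact: measurable_translation_set_rV.
pose fe (x : 'rV[R]_n) := f (x + e); pose g (x : 'rV[R]_n) := fe x - f x.
have mfe : measurable_fun setT fe.
  exact: (measurableT_comp mf (measurable_translation_rV e)).
have mg : measurable_fun setT g by exact: measurable_funB.
have SA : (\int[lebesgue_rV n]_(x in S) `|(f x)%:E| =
    \int[lebesgue_rV n]_(x in A) `|(fe x)%:E|)%E.
  rewrite -(ge0_integral_translation_rV e mS mnf)//.
  have -> : [set x : 'rV[R]_n | S (x + e)] = A; last by [].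
  by apply/seteqP; split=> x; rewrite /S/= addrK.
have BI : (\int[lebesgue_rV n]_(x in B) `|(f x)%:E| =
    \int[lebesgue_rV n]_(x in A) `|(f x)%:E| +
    \int[lebesgue_rV n]_(x in A) `|(fe x)%:E|)%E.
  rewrite BE ge0_integral_setU ?SA//; first exact: measurable_funTS.
  by rewrite disj_set2E AI.
have AB : (\int[lebesgue_rV n]_(x in A) `|(f x)%:E| <=
    \int[lebesgue_rV n]_(x in A) `|(fe x)%:E| +
    \int[lebesgue_rV n]_(x in A) `|(g x)%:E|)%E.
  rewrite -ge0_integralD//; last 2 first.
  - by apply: measurable_funTS; exact: mabs.
  - by apply: measurable_funTS; exact: mabs.
  apply: ge0_le_integral_nomeas => // x _; rewrite lee_fin.
  rewrite -[X in `|X| <= _](subKr (fe x)) -/(g x).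
  exact: ler_normB.
have gN : (\int[lebesgue_rV n]_(x in A) `|(g x)%:E| <=
    (h * m `^ (1 - p^-1))%:E * N)%E.
  have := @holder_set _ _ _ (lebesgue_rV n) p A g p1 mA mg.
  move=> /le_trans; apply.
  have -> : (lebesgue_rV n : {measure set 'rV[R]_n -> \bar R}) A = m%:E by [].
  rewrite poweR_EFin EFinM muleAC; apply: lee_wpmul2r.
    by rewrite lee_fin powR_ge0.
  apply: Lnorm_diff_le => //.
  - exact: smooth_continuous.
  - by move=> y; exact: smooth_derivable.
  - exact: smooth_partial_continuous.
set a := (\int[_]_(x in A) `|(f x)%:E|)%E in BI AB *.
set b := (\int[_]_(x in A) `|(fe x)%:E|)%E in BI AB.
have a0 : (0 <= a)%E by exact: integral_ge0.
have b0 : (0 <= b)%E by exact: integral_ge0.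
have N0 : (0 <= N)%E by exact: Lnorm_ge0.
have c0 : 0 <= (2 * m)^-1 by rewrite invr_ge0 mulr_ge0// ltW.
have -> : (m^-1%:E * a = (2 * m)^-1%:E * (a + a))%E.
  rewrite (ge0_muleDr _ a0 a0) -ge0_muleDl ?lee_fin//.
  rewrite -EFinD; congr (_%:E * _)%E.
  by rewrite invfM -mulrDl -[X in X + X]mul1r -splitr mul1r.
have hm0 : 0 <= h * m `^ (1 - p^-1) by rewrite mulr_ge0 ?powR_ge0.
apply: (@le_trans _ _ ((2 * m)^-1%:E * (a + (b +
   (h * m `^ (1 - p^-1))%:E * N)))%E).
  apply: lee_wpmul2l; first by rewrite lee_fin.
  by rewrite leeD2l//; apply: (le_trans AB); exact: leeD2l.
have hN0 : (0 <= (h * m `^ (1 - p^-1))%:E * N)%E by exact: mule_ge0.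
rewrite BI addeA (ge0_muleDr _ (adde_ge0 a0 b0) hN0).
rewrite leeD2l// muleA -EFinM; apply: lee_wpmul2r => //.
rewrite lee_fin mulrCA ler_wpM2l//.
have -> : m `^ (1 - p^-1) = m * m `^ (- p^-1).
  by rewrite powRD ?powRr1 ?ltW// (gt_eqF m0) implybT.
rewrite mulrA ler_piMl ?powR_ge0//.
by rewrite invfM mulfVK ?gt_eqF// invf_le1// ler1n.
Qed.

(** The product of the sets [X i]. *)
Definition box (X : 'I_n -> set R) : set 'rV[R]_n :=
  [set x | forall i, X i (x ord0 i)].

(** The product of [n] copies of [X]. *)
Definition cube (X : set R) : set 'rV[R]_n := box (fun=> X).

Lemma measurable_box (X : 'I_n -> set R) :
  (forall i, measurable (X i)) -> measurable (box X).
Proof.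
move=> mX; rewrite (_ : box X = \bigcap_(i in [set: 'I_n])
    ((fun x : 'rV[R]_n => x ord0 i) @^-1` X i)); last first.
  by apply/seteqP; split=> x bx i; [move=> _; exact: bx|exact: bx].
apply: fin_bigcap_measurable => // i _.
by rewrite -[X in measurable X]setTI; exact: measurable_coord.
Qed.

Lemma lebesgue_rV_boxE (X : 'I_n -> set R) (m : 'I_n -> R) :
  (forall i, measurable (X i)) ->
  (forall i, lebesgue_measure (X i) = (m i)%:E) ->
  lebesgue_rV n (box X) = (\prod_(i < n) m i)%:E.
Proof.
move=> mX Xm; rewrite lebesgue_rV_box// (big_morph EFin EFinM erefl).
by apply: eq_bigr => i _; rewrite Xm.
Qed.

(** If [Y] is the disjoint union of [X] and of its translate by [h], then one
    passes from the cube over [X] to the cube over [Y] by doubling one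
    coordinate at a time. *)
Lemma cube_average_step (p h m : R) f (X Y : set R) :
  1 < p -> 0 <= h -> 0 < m -> smooth f ->
  measurable X -> measurable Y ->
  lebesgue_measure X = m%:E -> lebesgue_measure Y = (2 * m)%:E ->
  Y = X `|` [set y | X (y - h)] -> X `&` [set y | X (y - h)] = set0 ->
  ((m ^+ n)^-1%:E * \int[lebesgue_rV n]_(x in cube X) `|(f x)%:E| <=
   ((2 * m) ^+ n)^-1%:E * \int[lebesgue_rV n]_(x in cube Y) `|(f x)%:E| +
   (h * m `^ (- (n%:R / p)))%:E *
     \sum_(k < n) 'N[lebesgue_rV n]_p%:E[EFin \o partial k f])%E.
Proof.
move=> p1 h0 m0 sf mX mY Xm Ym YE XI.
(* The product whose [j] first factors are [Y] and whose other factors are [X];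
   [w j] is its measure. *)
pose Z j (i : 'I_n) := if (i < j)%N then Y else X.
pose w j := \prod_(i < n) (if (i < j)%N then 2 * m else m).
have mZ j i : measurable (Z j i) by rewrite /Z; case: ifP.
have mbZ j : measurable (box (Z j)) by exact: measurable_box.
have Zw j : lebesgue_rV n (box (Z j)) = (w j)%:E.
  by apply: lebesgue_rV_boxE => // i; rewrite /Z; case: ifP.
have wm j : m ^+ n <= w j.
  rewrite -[n in m ^+ n]card_ord -prodr_const; apply: ler_prod => i _.
  by rewrite (ltW m0)/=; case: ifP => // _; lra.
have w0 j : 0 < w j by apply: lt_le_trans (wm j); exact: exprn_gt0.
have wS (j : 'I_n) : w j.+1 = 2 * w j.
  rewrite /w (bigD1 j)//= [in RHS](bigD1 j)//= ltnn ltnSn mulrA.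
  congr (_ * _); apply: eq_bigr => i ij.
  by rewrite ltnS leq_eqVlt (negbTE (_ : (i != j :> nat))).
pose N j : \bar R := 'N[lebesgue_rV n]_p%:E[EFin \o partial j f]%E.
have N0 j : (0 <= N j)%E by exact: Lnorm_ge0.
set c := h * m `^ (- (n%:R / p)).
have c0 : 0 <= c by rewrite mulr_ge0 ?powR_ge0.
pose av j : \bar R :=
  ((w j)^-1%:E * \int[lebesgue_rV n]_(x in box (Z j)) `|(f x)%:E|)%E.
have step (j : 'I_n) : (av j <= av j.+1 + c%:E * N j)%E.
  have shiftE (x : 'rV[R]_n) i : (x - h *: unit_vec j) ord0 i =
      if i == j then x ord0 i - h else x ord0 i.
    by rewrite !mxE eqxx /=; case: eqP => _; rewrite ?mulr1// mulr0 subr0.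
  have ZS i : i != j -> Z j.+1 i = Z j i.
    by move=> ij; rewrite /Z ltnS leq_eqVlt (negbTE (_ : (i != j :> nat))).
  have ZSj : Z j.+1 j = Y by rewrite /Z ltnSn.
  have Zj : Z j j = X by rewrite /Z ltnn.
  have BE : box (Z j.+1) =
      box (Z j) `|` [set x | box (Z j) (x - h *: unit_vec j)].
    apply/seteqP; split=> [x bx|x [] bx i].
    - have : Y (x ord0 j) by rewrite -ZSj; exact: bx.
      rewrite YE => -[Xx|Xx]; [left|right] => i.
        by have := bx i; case: (eqVneq i j) => [->|/ZS ->//]; rewrite Zj.
      rewrite shiftE; have := bx i; case: (eqVneq i j) => [->|/ZS ->//].
      by rewrite Zj.
    - have := bx i; case: (eqVneq i j) => [->|/ZS ->//].
      by rewrite Zj ZSj YE; left.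
    - have := bx i; rewrite shiftE; case: (eqVneq i j) => [->|/ZS ->//].
      by rewrite Zj ZSj YE; right.
  have BI : box (Z j) `&` [set x | box (Z j) (x - h *: unit_vec j)] = set0.
    rewrite -subset0 => x [/(_ j) + /(_ j)]; rewrite shiftE eqxx Zj => Xx Xh.
    by have : set0 (x ord0 j) by rewrite -XI; split.
  have := average_step p1 h0 (w0 j) sf (mbZ j) (mbZ j.+1) (Zw j) BE BI.
  move=> /le_trans; apply; rewrite /av wS leeD2l//.
  apply: lee_wpmul2r; first exact: N0.
  rewrite lee_fin ler_wpM2l//.
  rewrite -[n%:R / p]/(n%:R * p^-1) -mulrN powRrM powR_mulrn; last exact: ltW.
  rewrite !powRN lef_pV2 ?posrE ?powR_gt0 ?exprn_gt0//.
  have p0 : 0 < p by exact: lt_trans p1.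
  have := ltW m0; have := ltW (w0 j); have := ltW p0 => ? ? ?.
  by apply: ge0_ler_powR; rewrite ?nnegrE ?invr_ge0 ?exprn_ge0.
have chain j : (j <= n)%N ->
    (av 0%N <= av j + c%:E * \sum_(k < n | (k < j)%N) N k)%E.
  elim: j => [_|j IHj jn].
    by rewrite big_pred0// mule0 adde0.
  apply: (le_trans (IHj (ltnW jn))).
  rewrite [in leRHS](bigD1 (Ordinal jn))//= ge0_muleDr//; last first.
    by apply: sume_ge0.
  rewrite addeA; apply: leeD; first exact: step (Ordinal jn).
  rewrite le_eqVlt; apply/orP; left; apply/eqP; congr (_ * _)%E.
  apply: eq_bigl => k; rewrite ltnS (ltn_neqAle k j) andbC.
  by congr (_ && _).
have := chain n (leqnn n); rewrite /av.
have -> : w 0%N = m ^+ n.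
  by rewrite /w (eq_bigr (fun=> m))// prodr_const card_ord.
have -> : w n = (2 * m) ^+ n.
  rewrite /w (eq_bigr (fun=> 2 * m)); first by rewrite prodr_const card_ord.
  by move=> i _; rewrite ltn_ord.
have -> : Z n = fun=> Y by apply/funext => i; rewrite /Z ltn_ord.
have -> : Z 0%N = fun=> X by apply/funext => i; rewrite /Z ltn0.
by under eq_bigl do rewrite ltn_ord.
Qed.

End averages.

(** * Cantor sets *)

(** Whether [m] is the integer written with the [i] first binary digits of a
    point of the Cantor set: for each [j < i] with [S j], the digit of rank
    [j.+1] must be [0]. *)
Fixpoint cantor_code (S : nat -> bool) (i m : nat) : bool :=
  if i is j.+1 then cantor_code S j m./2 && (S j ==> ~~ odd m) else m == 0%N.

(** The number of digits that are forced to be [0] among the [i] first ones. *)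
Fixpoint forced (S : nat -> bool) (i : nat) : nat :=
  if i is j.+1 then (forced S j + S j)%N else 0%N.

Lemma cantor_code_lt S i m : cantor_code S i m -> (m < 2 ^ i)%N.
Proof.
elim: i m => [m /eqP ->//|i IHi m /= /andP[/IHi mi _]].
rewrite expnS -[m in (m < _)%N]odd_double_half mul2n.
apply: (@leq_ltn_trans (m./2.*2.+1)); first by case: odd; rewrite ?leqnSn.
by rewrite -doubleS leq_double in mi * .
Qed.

Lemma cantor_code_double S i j m :
  cantor_code S i m -> cantor_code S (i + j) (m * 2 ^ j).
Proof.
move=> im; elim: j => [|j IHj]; first by rewrite addn0 muln1.
rewrite addnS /= expnS mulnCA mul2n doubleK odd_double implybT andbT.
exact: IHj.
Qed.

Section cantor.
Context {R : realType}.
Implicit Types (S : nat -> bool) (x : R).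

(** The points of [0, 1) whose [i] first binary digits satisfy the constraints;
    a finite union of dyadic intervals of length [2 ^- i]. *)
Definition cantor S (i : nat) : set R :=
  [set x | 0 <= x /\ cantor_code S i (Num.truncn (2 ^+ i * x))].

Lemma truncn_double x : 0 <= x -> (Num.truncn (2 * x))./2 = Num.truncn x.
Proof.
move=> x0; have x20 : 0 <= 2 * x by rewrite mulr_ge0.
apply/esym/eqP; rewrite truncn_eq//.
have /andP[h1 h2] := truncn_itv x20.
set t := Num.truncn (2 * x) in h1 h2 *.
have te : t%:R = (odd t)%:R + 2 * t./2%:R :> R.
  by rewrite -natrM -natrD mul2n odd_double_half.
have ot : (odd t)%:R <= 1 :> R by case: odd.
have ot0 : 0 <= (odd t)%:R :> R by [].
by move: h1 h2; rewrite -!natr1 te => h1 h2; apply/andP; split; lra.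
Qed.

Lemma cantor0 S : cantor S 0 = `[0, 1[%classic.
Proof.
apply/seteqP; split=> x; rewrite /cantor/= expr0 mul1r in_itv/=.
  move=> [x0 /eqP t0]; rewrite x0/=.
  by have /andP[_] := truncn_itv x0; rewrite t0.
by move=> /andP[x0 x1]; split => //; apply/eqP/truncn_def; rewrite x0.
Qed.

Lemma cantorSE S i x : cantor S i.+1 x <->
  cantor S i x /\ (S i ==> ~~ odd (Num.truncn (2 ^+ i.+1 * x))).
Proof.
split=> [[x0 /= /andP[cx ox]]|[[x0 cx] ox]]; split => //=.
  by split => //; move: cx; rewrite exprS -mulrA truncn_double ?mulr_ge0.
by rewrite ox andbT exprS -mulrA truncn_double ?mulr_ge0.
Qed.

Lemma cantor_free S i : ~~ S i -> cantor S i.+1 = cantor S i.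
Proof.
move=> Si; apply/seteqP; split=> x; first by move=> /cantorSE[].
by move=> cx; apply/cantorSE; rewrite (negbTE Si).
Qed.

Lemma cantor_le S i j : (i <= j)%N -> cantor S j `<=` cantor S i.
Proof.
move=> /subnK <-; elim: (j - i)%N => [//|k IHk x].
by rewrite addSn => /cantorSE[/IHk].
Qed.

Lemma truncnB1 x : 1 <= x -> Num.truncn x = (Num.truncn (x - 1)).+1.
Proof.
move=> x1; apply: truncn_def; have := @truncn_itv R (x - 1).
by rewrite subr_ge0 => /(_ x1) /andP[]; rewrite -!natr1 => *; apply/andP; split; lra.
Qed.

Lemma cantor_translate S i x : cantor S i.+1 (x - 2 ^- i.+1) <->
  1 <= 2 ^+ i.+1 * x /\ cantor_code S i.+1 (Num.truncn (2 ^+ i.+1 * x) - 1).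
Proof.
have p2 : 0 < 2 ^+ i.+1 :> R by rewrite exprn_gt0.
have E : (0 <= x - 2 ^- i.+1) = (1 <= 2 ^+ i.+1 * x).
  by rewrite subr_ge0 -(ler_pM2l p2) mulfV ?gt_eqF.
rewrite /cantor/mkset E mulrBr mulfV ?gt_eqF//.
by split=> -[x1 cx]; split => //; move: cx; rewrite (truncnB1 x1) subn1.
Qed.

Lemma cantor_forced_disj S i : S i ->
  cantor S i.+1 `&` [set x | cantor S i.+1 (x - 2 ^- i.+1)] = set0.
Proof.
move=> Si; rewrite -subset0 => x [[_ /= + /cantor_translate[x1 /=]]].
by rewrite Si (truncnB1 x1) subn1/= => /andP[_ /negP + /andP[_]].
Qed.

Lemma cantor_forcedE S i : S i ->
  cantor S i = cantor S i.+1 `|` [set x | cantor S i.+1 (x - 2 ^- i.+1)].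
Proof.
move=> Si; apply/seteqP; split=> [x cx|x [/cantorSE[]//|]].
  have [ot|ot] := boolP (odd (Num.truncn (2 ^+ i.+1 * x))); last first.
    by left; apply/cantorSE; rewrite ot implybT.
  right; apply/cantor_translate; case: cx => x0 cx.
  have x1 : 1 <= 2 ^+ i.+1 * x by rewrite -truncn_gt0; case: (Num.truncn _) ot.
  have {}cx : cantor_code S i (Num.truncn (2 ^+ i.+1 * x))./2.
    by rewrite exprS -mulrA truncn_double ?mulr_ge0.
  split => //=; move: ot cx; rewrite (truncnB1 x1) subn1/= Si => ot.
  by rewrite uphalf_half (negbTE ot) add0n => ->.
move=> /cantor_translate[x1 /=]; rewrite Si => /andP[+ ot].
have p2 j : 0 < 2 ^+ j :> R by rewrite exprn_gt0.
have x0 : 0 <= x by rewrite -(pmulr_rge0 _ (p2 i.+1)); exact: le_trans x1.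
move=> cx; split => //; rewrite -truncn_double ?mulr_ge0// mulrA -exprS.
by move: cx ot; rewrite (truncnB1 x1) subn1/= uphalf_half => + /negbTE ->.
Qed.

Lemma measurable_cantor S i : measurable (cantor S i).
Proof.
rewrite (_ : cantor S i = \bigcup_(m in [set m | cantor_code S i m])
    `[m%:R / 2 ^+ i, m.+1%:R / 2 ^+ i[%classic).
  by apply: bigcup_measurable => m _; exact: measurable_itv.
have p2 : 0 < 2 ^+ i :> R by rewrite exprn_gt0.
apply/seteqP; split=> [x [x0 cx]|x [m /= cm]].
  exists (Num.truncn (2 ^+ i * x)) => //=.
  rewrite in_itv/= ler_pdivrMr// ltr_pdivlMr// mulrC; apply: truncn_itv.
  by rewrite mulr_ge0// ltW.
rewrite in_itv/= ler_pdivrMr// ltr_pdivlMr// mulrC => xm; split.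
  by rewrite -(pmulr_rge0 _ p2); case/andP: xm => + _; apply: le_trans.
by rewrite (truncn_def xm).
Qed.

Lemma lebesgue_measure_cantor S i :
  lebesgue_measure (cantor S i) = (2 ^- forced S i)%:E.
Proof.
elim: i => [|i IHi].
  by rewrite cantor0 lebesgue_measure_itv/= lte01 oppr0 adde0 expr0 invr1.
rewrite /=; case: (boolP (S i)) => [Si|/cantor_free ->]; last by rewrite addn0.
have mC := measurable_cantor S i.+1.
have mC' : measurable [set x | cantor S i.+1 (x - 2 ^- i.+1)].
  have := @measurable_funB _ _ R setT id (cst (2 ^- i.+1)) (@measurable_id _ _ _)
    (measurable_cst _) measurableT _ mC.
  by rewrite setTI.
have U : lebesgue_measure (cantor S i) = (lebesgue_measure (cantor S i.+1) +
    lebesgue_measure (cantor S i.+1))%E.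
  rewrite {1}(cantor_forcedE Si) measureU//; last exact: cantor_forced_disj.
  by congr (_ + _)%E; exact: lebesgue_measure_translation.
move: IHi; rewrite U addn1 exprS invfM; case: (lebesgue_measure _) => //= y [yy].
by congr EFin; lra.
Qed.

Lemma cantor_itv S i x : cantor S i x -> 0 <= x < 1.
Proof. by move=> /(cantor_le (leq0n i)); rewrite cantor0/= in_itv. Qed.

(** The digits after the [i]th can be replaced with zeros. *)
Lemma cantor_round S i x : cantor S i x ->
  exists2 y, forall j, cantor S j y & `|x - y| <= 2 ^- i.
Proof.
move=> [x0 cx]; set m := Num.truncn (2 ^+ i * x) in cx.
have p2 j : 0 < 2 ^+ j :> R by rewrite exprn_gt0.
have y0 : 0 <= m%:R / 2 ^+ i :> R by rewrite divr_ge0// ltW.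
have cge j : cantor S (i + j) (m%:R / 2 ^+ i).
  split => //; rewrite exprD mulrAC mulrCA mulfV ?gt_eqF// mulr1.
  by rewrite -natrX -natrM natrK; exact: cantor_code_double.
exists (m%:R / 2 ^+ i) => [j|].
  apply: (@cantor_le _ j (i + j)); first exact: leq_addl.
  exact: cge.
have /andP[mx xm] : m%:R <= 2 ^+ i * x < m.+1%:R.
  by apply: truncn_itv; rewrite mulr_ge0// ltW.
rewrite ger0_norm; last by rewrite subr_ge0 ler_pdivrMr// mulrC.
rewrite lerBlDr (_ : _ + _ = m.+1%:R / 2 ^+ i).
  by rewrite ltW// ltr_pdivlMr// mulrC.
by rewrite -(natr1 m) mulrDl mul1r addrC.
Qed.

End cantor.

(** * The choice of the forced digits *)

Section greedy.
Context {R : realType}.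
Variable rho : R.

(** The number of digits forced among the [i] first ones by the following rule:
    the digit of rank [j.+1] is forced when [rho ^+ greedy_count j.+1 / 2 ^+ j.+1]
    is then at most [1 / ((j + 1) * (j + 2))], the term of a convergent series. *)
Fixpoint greedy_count (i : nat) : nat :=
  if i is j.+1 then
    (greedy_count j +
     (rho ^+ (greedy_count j).+1 / 2 ^+ j.+1 <= (j.+1 * j.+2)%:R^-1)%R)%N
  else 0%N.

(** Whether the digit of rank [j.+1] is forced to be [0]. *)
Definition greedy (j : nat) : bool :=
  rho ^+ (greedy_count j).+1 / 2 ^+ j.+1 <= (j.+1 * j.+2)%:R^-1.

Lemma forced_greedy i : forced greedy i = greedy_count i.
Proof. by elim: i => //= i ->. Qed.

Lemma greedy_le j : greedy j ->
  rho ^+ forced greedy j.+1 / 2 ^+ j.+1 <= (j.+1 * j.+2)%:R^-1.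
Proof. by move=> gj; rewrite /= gj forced_greedy addn1. Qed.

(** Conversely, [rho ^+ forced greedy i / 2 ^+ i] decreases no faster than the
    inverse of a quadratic polynomial in [i]. *)
Lemma greedy_ge i : 2 < rho ->
  2 ^+ i <= rho ^+ (forced greedy i).+1 * (i.+1 * i.+2)%:R.
Proof.
move=> rho2; have rho0 : 0 < rho by exact: lt_trans rho2.
elim: i => [|i IHi]; first by rewrite /= expr0 expr1 mul1n; lra.
have le_ij : (i.+1 * i.+2)%:R <= (i.+2 * i.+3)%:R :> R.
  by rewrite ler_nat mulnC leq_mul2l ltnW ?orbT.
rewrite /=; case: (boolP (greedy i)) => gi; rewrite ?addn1 ?addn0.
  (* One more power of [rho], which exceeds [2], compensates the factor [2]. *)
  rewrite [in leRHS]exprS [in leLHS]exprS -mulrA.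
  apply: ler_pM; rewrite ?exprn_ge0//; first exact: ltW.
  apply: (le_trans IHi); apply: ler_wpM2l => //.
  by rewrite exprn_ge0// ltW.
move: gi; rewrite /greedy -ltNge forced_greedy => gi.
apply: (@le_trans _ _ (rho ^+ (greedy_count i).+1 * (i.+1 * i.+2)%:R)).
  rewrite ltW// -ltr_pdivrMr ?ltr0n ?muln_gt0//.
  by move: gi; rewrite ltr_pdivlMr ?exprn_gt0// mulrC.
by rewrite ler_wpM2l// exprn_ge0// ltW.
Qed.

Lemma sum_greedy_le I : 0 <= rho ->
  \sum_(0 <= j < I | greedy j) rho ^+ forced greedy j.+1 / 2 ^+ j.+1 <= 1.
Proof.
move=> rho0; apply: (@le_trans _ _ (\sum_(0 <= j < I) (j.+1 * j.+2)%:R^-1)).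
  rewrite big_mkcond; apply: ler_sum => j _; case: ifPn => [/greedy_le//|_].
  by rewrite invr_ge0.
have tele (a : R) : a != 0 -> a + 1 != 0 ->
    1 - a^-1 + (a * (a + 1))^-1 = 1 - (a + 1)^-1.
  by move=> a0 a1; field; rewrite a0 a1.
(* The sum telescopes. *)
have -> : \sum_(0 <= j < I) (j.+1 * j.+2)%:R^-1 = 1 - I.+1%:R^-1 :> R.
  elim: I => [|I IHI]; first by rewrite big_nil invr1 subrr.
  rewrite big_nat_recr//= IHI natrM.
  have h1 : I.+1%:R != 0 :> R by rewrite pnatr_eq0.
  have h2 : I.+2%:R != 0 :> R by rewrite pnatr_eq0.
  have h : I.+2%:R = I.+1%:R + 1 :> R by rewrite natr1.
  rewrite h in h2 *; exact: tele.
by rewrite gerBl invr_ge0.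
Qed.

End greedy.

(** * Functions with compact support *)

Section compact_support.
Context {R : realType} {n : nat}.
Implicit Types (f : 'rV[R]_n -> R).

Lemma unif_continuous_compact f (K : set 'rV[R]_n) (eps : R) :
  compact K -> continuous f -> 0 < eps ->
  \forall i \near \oo, forall x y : 'rV[R]_n, K x ->
    (forall j, `|x ord0 j - y ord0 j| <= 2 ^- i) -> `|f x - f y| < eps.
Proof.
move=> cK cf e0.
pose P (i : nat) (x : 'rV[R]_n) := forall y : 'rV[R]_n,
  (forall j, `|x ord0 j - y ord0 j| <= 2 ^- i) -> `|f x - f y| < eps.
suff H : \forall i \near \oo, K `<=` P i.
  by apply: filterS H => i H x y Kx; exact: H.
have /compact_near_coveringP cov := cK; apply: cov => x Kx.
have /cvgrPdist_lt/(_ (eps / 2)) := cf x; rewrite divr_gt0// => /(_ erefl).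
move=> /nbhs_ballP[d /= d0 fd].
have d20 : 0 < d / 2 by rewrite divr_gt0.
exists (ball x (d / 2), [set i | 2 ^- i < d / 2]).
  split; first exact: nbhsx_ballx.
  have := near_infty_natSinv_expn_lt (PosNum d20).
  by apply: filterS => i /=; rewrite div1r.
move=> [x' i] /= [[_ xx'] id] y x'y.
have fx' : `|f x - f x'| < eps / 2.
  apply: fd; split => // i' j; apply: le_ball (xx' i' j).
  by rewrite ler_pdivrMr// ler_peMr ?ltW// ltr1n.
have fy : `|f x - f y| < eps / 2.
  apply: fd; split => // i' j; rewrite [d]splitr.
  apply: ball_triangle (xx' i' j) _; rewrite (ord1 i').
  exact: le_lt_trans (x'y j) id.
rewrite -(subrKA (f x)) (le_lt_trans (ler_normD _ _))// [ltRHS]splitr.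
by rewrite ltrD// distrC.
Qed.

Lemma compactly_supported_bounded f : compactly_supported f ->
  exists2 r : R, 0 < r & forall x, f x != 0 -> forall i, `|x ord0 i| <= r.
Proof.
move=> /compact_bounded[M [Mreal Mb]].
exists (Num.max M 0 + 1) => [|x fx i].
  by rewrite ltr_pwDr// le_max lexx orbT.
apply: (@le_trans _ _ `|x|).
  by rewrite [leRHS]/Num.norm /= mx_normrE; apply/bigmax_geP; right => /=;
    exists (ord0, i).
by apply: Mb; [rewrite ltr_pwDr// le_max lexx|exact: subset_closure].
Qed.

Lemma continuous_bounded f : compactly_supported f -> continuous f ->
  exists2 B : R, 0 < B & forall x, `|f x| <= B.
Proof.
move=> cpt cf.
have : compact (f @` closure [set x | f x != 0]).
  by apply: continuous_compact => //; exact: continuous_subspaceT.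
move=> /compact_bounded[M [Mreal Mb]].
have B0 : 0 < Num.max M 0 + 1 by rewrite ltr_pwDr// le_max lexx orbT.
exists (Num.max M 0 + 1) => // x.
have [->|fx] := eqVneq (f x) 0; first by rewrite normr0 ltW.
apply: Mb; first by rewrite ltr_pwDr// le_max lexx.
by exists x => //; exact: subset_closure.
Qed.

Lemma integral_compact_support_lty f :
  compactly_supported f -> continuous f ->
  (\int[lebesgue_rV n]_x `|(f x)%:E| < +oo)%E.
Proof.
move=> cpt cf; have [r r0 rf] := compactly_supported_bounded cpt.
have [B B0 Bf] := continuous_bounded cpt cf.
pose D := cube `[- r, r]%classic : set 'rV[R]_n.
have mD : measurable D by exact: measurable_box.
apply: (@le_lt_trans _ _ (\int[lebesgue_rV n]_(x in D) B%:E)%E).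
  rewrite [leRHS]integral_mkcond; apply: ge0_le_integral_nomeas => // x _.
  rewrite patchE; case: ifPn => [_|/negP xD]; first by rewrite lee_fin.
  have [->|fx] := eqVneq (f x) 0; first by rewrite /= normr0.
  exfalso; apply: xD; rewrite inE => i /=.
  by rewrite in_itv/= -ler_norml; exact: rf.
rewrite integral_cst//.
have -> : (lebesgue_rV n : {measure set 'rV[R]_n -> \bar R}) D =
    (\prod_(i < n) (2 * r))%:E; last by rewrite -EFinM ltry.
apply: lebesgue_rV_boxE => // _.
rewrite lebesgue_measure_itv/= lte_fin gtrN// -EFinD.
by congr EFin; rewrite opprK mulr2n mulrDl !mul1r.
Qed.

End compact_support.

(** * Positivity of the Sobolev capacity *)

Section sobolev.
Context {R : realType} {n : nat}.
Variable p : R.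
Hypothesis p1 : 1 < p.
Hypothesis pn : p < n%:R.
Implicit Types (f : 'rV[R]_n -> R).

(** The ratio of the Cantor sets: forcing one more digit divides the measure of
    the [n]-dimensional set by [2 ^+ n], hence multiplies its power
    [- p^-1] by [ratio]. *)
Definition ratio : R := 2 `^ (n%:R / p).

Let p0 : 0 < p. Proof. exact: lt_trans p1. Qed.

Lemma ratio_gt2 : 2 < ratio.
Proof.
have a0 : 0 < n%:R / p - 1 by rewrite subr_gt0 ltr_pdivlMr// mul1r.
rewrite /ratio -[X in _ `^ X](subrK 1) powRD ?pnatr_eq0 ?implybT// powRr1//.
rewrite -[ltLHS]mul1r ltr_pM2r//.
have := @gt0_ltr_powR R _ a0 1 2; rewrite powR1; apply; rewrite ?nnegrE ?ltr1n//.
Qed.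

Lemma powR_ratio k : (2 ^- k) `^ (- (n%:R / p)) = ratio ^+ k.
Proof.
by rewrite -powR_invn// -powRrM mulrNN mulrC powRrM powR_mulrn// powR_ge0.
Qed.

Lemma powR_ratioV k : (2 ^+ k) `^ (- (n%:R / p)) = ratio ^- k.
Proof. by rewrite powRN -powR_mulrn// -powRrM mulrC powRrM powR_mulrn ?powR_ge0. Qed.

Let S := greedy ratio.

(** The sum of the L^p norms of the partial derivatives. *)
Definition gradient_norm f : \bar R :=
  (\sum_(k < n) 'N[lebesgue_rV n]_p%:E[EFin \o partial k f])%E.

Lemma gradient_norm_ge0 f : (0 <= gradient_norm f)%E.
Proof. by apply: sume_ge0 => k _; exact: Lnorm_ge0. Qed.

(** The average of [`|f|] over the [n]-dimensional Cantor set of rank [i]. *)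
Let cantor_av f i : \bar R := (((2 ^- forced S i) ^+ n)^-1%:E *
  \int[lebesgue_rV n]_(x in cube (cantor S i)) `|(f x)%:E|)%E.

(** The average of [`|f|] over the cube [0, 2 ^ j)^n. *)
Let itv_av f j : \bar R := (((2 ^+ j) ^+ n)^-1%:E *
  \int[lebesgue_rV n]_(x in cube `[0%R, (2 ^+ j)%R[%classic) `|(f x)%:E|)%E.

(** Only the forced digits contribute: the Cantor set does not change at the
    other ones. *)
Lemma cantor_av_le f i : smooth f ->
  (cantor_av f i <= cantor_av f 0 +
   (\sum_(0 <= j < i | S j) ratio ^+ forced S j.+1 / 2 ^+ j.+1)%:E *
   gradient_norm f)%E.
Proof.
move=> sf; have r0 : 0 <= ratio by exact: powR_ge0.
elim: i => [|i IHi]; first by rewrite big_nil mul0e adde0.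
rewrite big_mkcond big_nat_recr//= -big_mkcond/=.
have [Si|Si] := boolP (S i); last first.
  by rewrite addr0 {1}/cantor_av /= (negbTE Si) addn0 cantor_free.
apply: (@le_trans _ _ (cantor_av f i +
    (ratio ^+ forced S i.+1 / 2 ^+ i.+1)%:E * gradient_norm f)%E); last first.
  rewrite EFinD ge0_muleDl ?lee_fin//; last 2 first.
  - by apply: sumr_ge0 => j _; rewrite divr_ge0 ?exprn_ge0.
  - by rewrite divr_ge0 ?exprn_ge0.
  by rewrite addeA; apply: leeD => //=; rewrite Si.
have m0 : 0 < 2 ^- forced S i.+1 :> R by rewrite invr_gt0 exprn_gt0.
have h0 : 0 <= 2 ^- i.+1 :> R by rewrite invr_ge0 exprn_ge0.
have E2 : 2 ^- forced S i = 2 * 2 ^- forced S i.+1 :> R.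
  by rewrite /= Si addn1 exprS invfM mulrA mulfV ?mul1r.
have := cube_average_step p1 h0 m0 sf (measurable_cantor S i.+1)
  (measurable_cantor S i) (lebesgue_measure_cantor S i.+1) _
  (cantor_forcedE Si) (cantor_forced_disj Si).
rewrite -E2 => /(_ (lebesgue_measure_cantor S i)).
by rewrite powR_ratio mulrC.
Qed.

(** At the large scales, the terms are those of a geometric series; its ratio is
    less than [1] because [p < n]. *)
Lemma itv_av_le f j : smooth f ->
  (itv_av f 0 <= itv_av f j +
   (\sum_(0 <= i < j) (2 / ratio) ^+ i)%:E * gradient_norm f)%E.
Proof.
move=> sf; have r0 : 0 <= ratio by exact: powR_ge0.
elim: j => [|j IHj]; first by rewrite big_nil mul0e adde0.
apply: (le_trans IHj); rewrite big_nat_recr//= addrC EFinD.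
rewrite ge0_muleDl ?lee_fin//; last 2 first.
- by rewrite exprn_ge0// divr_ge0.
- by apply: sumr_ge0 => i _; rewrite exprn_ge0// divr_ge0.
rewrite addeA; apply: leeD => //.
have m0 : 0 < 2 ^+ j :> R by rewrite exprn_gt0.
have itvm (b : R) : 0 < b -> lebesgue_measure `[0, b[%classic = b%:E.
  by move=> b0; rewrite lebesgue_measure_itv/= lte_fin b0 oppr0 adde0.
have itvU (a : R) : 0 < a -> `[0, 2 * a[%classic =
    `[0, a[%classic `|` [set y | `[0, a[%classic (y - a)].
  move=> a0; apply/seteqP; split=> [x|x []]; rewrite /= !in_itv/=.
  - by move=> /andP[x0 xa]; have [xa'|xa'] := ltP x a; [left|right];
      apply/andP; split; lra.
  - by move=> /andP[x0 xa]; apply/andP; split; lra.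
  - by move=> /andP[x0 xa]; apply/andP; split; lra.
have itvI (a : R) :
    `[0, a[%classic `&` [set y | `[0, a[%classic (y - a)] = set0.
  rewrite -subset0 => x [] /=; rewrite !in_itv/= => /andP[? ?] /andP[? ?].
  by exfalso; lra.
have := cube_average_step p1 (ltW m0) m0 sf (measurable_itv _)
  (measurable_itv _) (itvm _ m0) (itvm _ (mulr_gt0 (ltr0Sn _ 1) m0))
  (itvU _ m0) (itvI _).
by rewrite -exprS powR_ratioV -expr_div_n.
Qed.

(** The set of the points of [0, 1)^n all of whose constrained digits are [0] in
    each coordinate; it is not closed, but continuous functions do not see the
    difference with its closure. *)
Definition cantor_points : set 'rV[R]_n := cube [set x | forall i, cantor S i x].

Definition cantor_set : set 'rV[R]_n := closure cantor_points.

Let unit_cube : set 'rV[R]_n := cube `[0, 1]%classic.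

Let compact_unit_cube : compact unit_cube.
Proof.
by apply: (@rV_compact R n (fun=> `[0, 1]%classic)) => _; exact: segment_compact.
Qed.

Lemma compact_cantor_set : compact cantor_set.
Proof.
apply: (subclosed_compact _ compact_unit_cube); first exact: closed_closure.
have cl : closed unit_cube.
  exact: compact_closed (@norm_hausdorff _ _) compact_unit_cube.
rewrite (iffLR (closure_id _) cl); apply: closureS => x cx i.
by have /andP[x0 /ltW x1] := cantor_itv (cx i 0%N); rewrite /= in_itv/= x0.
Qed.

(** [`|f|] is at least [1 / 2] on the Cantor sets of large rank, by uniform
    continuity, whereas its average over [0, 2 ^ J)^n tends to [0] because it is
    integrable; the difference is controlled by the two sums over scales. *)
Lemma gradient_norm_ge f : admissible cantor_set f ->
  (4^-1%:E <= ((1 - 2 / ratio)^-1 + 1)%:E * gradient_norm f)%E.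
Proof.
move=> [sf cpt f1]; have cf := smooth_continuous sf.
have n0 : (0 < n)%N by rewrite -(ltr0n R); exact: lt_trans pn.
have r2 := ratio_gt2; have r0 : 0 < ratio by exact: lt_trans r2.
have q0 : 0 <= 2 / ratio by rewrite divr_ge0// ltW.
have q1 : 2 / ratio < 1 by rewrite ltr_pdivrMr// mul1r.
have N0 := gradient_norm_ge0 f.
have h0 : 0 < 2^-1 :> R by rewrite invr_gt0.
have [I _ /(_ I (leqnn I)) fI] :=
  unif_continuous_compact compact_unit_cube cf h0.
have avI : (2^-1%:E <= cantor_av f I)%E.
  rewrite /cantor_av; set A := cube _; set m := (2 ^- forced S I) ^+ n.
  have m0 : 0 < m by rewrite exprn_gt0// invr_gt0 exprn_gt0.
  have mA : measurable A by apply: measurable_box => _; exact: measurable_cantor.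
  have Am : (lebesgue_rV n : {measure set 'rV[R]_n -> \bar R}) A = m%:E.
    have -> : m = \prod_(i < n) 2 ^- forced S I.
      by rewrite prodr_const card_ord.
    apply: lebesgue_rV_boxE => _; first exact: measurable_cantor.
    exact: lebesgue_measure_cantor.
  rewrite -lee_pdivrMl// ?invr_gt0// invrK -Am -[X in (X <= _)%E]muleC.
  rewrite -integral_cst//; apply: ge0_le_integral_nomeas => x Ax.
    by rewrite lee_fin ltW.
  rewrite lee_fin.
  have /choice[y yP] : forall i : 'I_n, exists y : R,
      (forall j, cantor S j y) /\ `|x ord0 i - y| <= 2 ^- I.
    by move=> i; have [y ? ?] := cantor_round (Ax i); exists y.
  pose z : 'rV[R]_n := \row_i y i.
  have fz : 1 <= f z.
    by apply/f1/subset_closure => i j; rewrite mxE; case: (yP i).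
  have Kx : unit_cube x.
    move=> i; have /andP[x0 /ltW x1] := cantor_itv (Ax i).
    by rewrite /= in_itv/= x0.
  have := fI x z Kx; have xz i : `|x ord0 i - z ord0 i| <= 2 ^- I.
    by rewrite mxE; case: (yP i).
  move=> /(_ xz); rewrite distrC; have := ler_norm (f z - f x).
  by have := ler_norm (f x); lra.
have cI := cantor_av_le I sf.
have [M fM M0] : exists2 M : R,
    (\int[lebesgue_rV n]_x `|(f x)%:E| = M%:E)%E & 0 <= M.
  have foo := integral_compact_support_lty cpt cf.
  have i0 : (0 <= \int[lebesgue_rV n]_x `|(f x)%:E|)%E by exact: integral_ge0.
  exists (fine (\int[lebesgue_rV n]_x `|(f x)%:E|)%E); last exact: fine_ge0.
  by rewrite fineK// ge0_fin_numE.
have [J MJ] : exists J, M / 2 ^+ J <= 4^-1.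
  exists (Num.truncn (4 * M)).+1; set J := (Num.truncn _).+1.
  have J0 : 0 < 2 ^+ J :> R by rewrite exprn_gt0.
  rewrite ler_pdivrMr// ler_pdivlMl//.
  apply: (le_trans (ltW (truncnS_gt _))); rewrite -/J -natrX ler_nat.
  exact/ltnW/ltn_expl.
have avJ : (itv_av f J <= 4^-1%:E)%E.
  have J1 : 1 <= 2 ^+ J :> R by rewrite exprn_ege1// ler1n.
  have J0 : 0 < 2 ^+ J :> R by exact: lt_le_trans J1.
  have Jn : 0 < (2 ^+ J) ^+ n :> R by rewrite exprn_gt0.
  apply: (@le_trans _ _ (((2 ^+ J) ^+ n)^-1%:E * M%:E)%E).
    apply: lee_wpmul2l; first by rewrite lee_fin invr_ge0 ltW.
    rewrite -fM [leLHS]integral_mkcond; apply: ge0_le_integral_nomeas => x _.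
      by apply: erestrict_ge0.
    by rewrite patchE; case: ifPn => // _; rewrite lee_fin.
  rewrite -EFinM lee_fin mulrC; apply: le_trans MJ; apply: ler_wpM2l => //.
  by rewrite lef_pV2 ?posrE// ler_eXnr.
have dJ := itv_av_le J sf.
have av0 : cantor_av f 0 = itv_av f 0.
  by rewrite /cantor_av /itv_av cantor0 /= !expr0 invr1.
have sI : \sum_(0 <= j < I | S j) ratio ^+ forced S j.+1 / 2 ^+ j.+1 <= 1.
  exact/sum_greedy_le/ltW.
have sJ : \sum_(0 <= i < J) (2 / ratio) ^+ i <= (1 - 2 / ratio)^-1.
  have -> : \sum_(0 <= i < J) (2 / ratio) ^+ i =
      (1 - (2 / ratio) ^+ J) * (1 - 2 / ratio)^-1.
    apply: (mulIf (_ : 1 - 2 / ratio != 0)); first by rewrite subr_eq0 gt_eqF.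
    rewrite mulfVK ?subr_eq0 ?gt_eqF//.
    elim: (J) => [|j IHj]; first by rewrite big_nil mul0r expr0 subrr.
    by rewrite big_nat_recr//= mulrDl IHj exprSr; ring.
  rewrite ler_piMl ?invr_ge0 ?subr_ge0 ?(ltW q1)//.
  by rewrite gerBl exprn_ge0.
have : (2^-1%:E <= 4^-1%:E + ((1 - 2 / ratio)^-1 + 1)%:E * gradient_norm f)%E.
  apply: (le_trans avI); apply: (le_trans cI); rewrite av0.
  apply: (@le_trans _ _ ((4^-1%:E + (1 - 2 / ratio)^-1%:E * gradient_norm f) +
    1%:E * gradient_norm f)%E).
    apply: leeD; last by apply: lee_wpmul2r.
    apply: (le_trans dJ); apply: leeD => //; exact: lee_wpmul2r.
  rewrite EFinD ge0_muleDl ?addeA// lee_fin invr_ge0 subr_ge0; exact: ltW.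
rewrite -leeBlDl// -EFinB; apply: le_trans; rewrite lee_fin; lra.
Qed.

End sobolev.

(** * A class of smooth functions *)

Section eta.
Context {R : realType}.
Implicit Types (P Q : {poly R}) (y : R).

(** [P (1 / y) * exp (- 1 / y)] extended by [0] for [y <= 0]: this family of
    functions is closed under differentiation. *)
Definition eta P y : R := if 0 < y then P.[y^-1] * expR (- y^-1) else 0.

(** The polynomial [Q] such that the derivative of [eta P] is [eta Q]. *)
Definition eta_deriv P : {poly R} := 'X^2 * (P - P^`()).

Lemma le_horner_exp Q : exists2 C : R, 0 <= C &
  forall u, 1 <= u -> `|Q.[u]| * u <= C * expR u.
Proof.
pose m := size Q; pose B := \sum_(i < m) `|Q`_i|.
have B0 : 0 <= B by apply: sumr_ge0.
exists (B * (m.+1)`!%:R) => [|u u1]; first by rewrite mulr_ge0.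
have u0 : 0 <= u by exact: le_trans u1.
have Qu : `|Q.[u]| <= B * u ^+ m.
  rewrite horner_coef mulr_suml; apply: (le_trans (ler_norm_sum _ _ _)).
  apply: ler_sum => i _; rewrite normrM ler_wpM2l// ger0_norm ?exprn_ge0//.
  by apply: ler_weXn2l => //; exact: ltnW.
rewrite -mulrA; apply: (@le_trans _ _ (B * u ^+ m * u)); first exact: ler_wpM2r.
rewrite -mulrA -exprSr ler_wpM2l// mulrC -ler_pdivrMr ?ltr0n ?fact_gt0//.
by apply: le_trans (expR_ge1Dxn m u0); rewrite lerDr.
Qed.

(** Applied to ['X * P], this linear bound shows that the difference quotient of
    [eta P] at [0] tends to [0]. *)
Lemma le_eta Q : exists2 C : R, 0 <= C & forall y, y <= 1 -> `|eta Q y| <= C * `|y|.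
Proof.
have [C C0 CQ] := le_horner_exp Q; exists C => // y y1.
rewrite /eta; case: ifPn => [y0|_]; last by rewrite normr0 mulr_ge0.
have yV : 1 <= y^-1 by rewrite invf_ge1.
have H := CQ _ yV; rewrite normrM (ger0_norm (expR_ge0 _)) expRN.
by rewrite ler_pdivrMr ?expR_gt0// (gtr0_norm y0) mulrAC -ler_pdivrMr.
Qed.

Lemma is_derive_eta P y : is_derive y 1 (eta P) (eta (eta_deriv P) y).
Proof.
have [y0|y0|->] := ltgtP y 0.
- have -> : eta (eta_deriv P) y = 0 by rewrite /eta ltNge (ltW y0).
  have d0 : is_derive y 1 (cst 0 : R -> R) 0 by exact: is_derive_cst.
  apply: near_eq_is_derive d0.
  near=> z; have z0 : z < 0 by near: z; exact: lt_nbhsl.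
  by rewrite /eta ltNge (ltW z0).
- have -> : eta (eta_deriv P) y =
      (eta_deriv P).[y^-1] * expR (- y^-1) by rewrite /eta y0.
  have dV : is_derive y 1 (fun z : R => z^-1) (- y ^- 2).
    have yN0 : id y != 0 by rewrite gt_eqF.
    have := is_deriveV yN0 (is_derive_id y 1).
    by rewrite -[_ *: _]/(_ * _) mulr1.
  have dP := is_derive1_comp (is_derive_poly P y^-1) dV.
  have dE := is_derive1_comp (f := expR) (g := fun z : R => - z^-1)
    (is_derive_expR (- y^-1)) (is_deriveN dV).
  have dM : is_derive y 1 (fun z => P.[z^-1] * expR (- z^-1))
      ((eta_deriv P).[y^-1] * expR (- y^-1)).
    have := is_deriveM dP dE; move=> /is_derive_eq; apply.
    rewrite /eta_deriv hornerM hornerXn hornerD hornerN /= -exprVn.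
    by rewrite -![_ *: _]/(_ * _); ring.
  apply: near_eq_is_derive dM.
  near=> z; have z0 : 0 < z by near: z; exact: lt_nbhsr.
  by rewrite /eta z0.
have e0 Q : eta Q 0 = 0 by rewrite /eta ltxx.
rewrite e0.
have [C C0 CP] := le_eta ('X * P).
have H : (fun h => h^-1 *: ((eta P \o shift 0) (h *: 1) - eta P 0)) @ 0^' --> 0.
  apply/cvgr0Pnorm_lt => e eps0; near=> h.
  have -> : h^-1 *: ((eta P \o shift 0) (h *: 1) - eta P 0) = eta ('X * P) h.
    rewrite e0 subr0 /= /shift/= addr0 -![_ *: _]/(_ * _) mulr1 /eta.
    by case: ifPn => _; rewrite ?mulr0// hornerM hornerX mulrA.
  have h1 : `|h| < 1 by near: h; apply: dnbhs0_lt.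
  have he : `|h| < e / (C + 1).
    by near: h; apply: dnbhs0_lt; rewrite divr_gt0// ltr_pwDr.
  have := CP h (le_trans (ler_norm h) (ltW h1)).
  move: he; rewrite ltr_pdivlMr ?ltr_pwDr//; have := normr_ge0 h.
  by move=> *; nra.
split; first by apply/cvg_ex; exists 0.
exact: cvg_lim H.
Unshelve. all: by end_near. Qed.

End eta.

Section eta_algebra.
Context {R : realType}.

(** The algebra generated by the functions [eta P] precomposed with affine
    maps. *)
Inductive eta_algebra : (R -> R) -> Prop :=
| eta_algebra_cst c : eta_algebra (fun=> c)
| eta_algebra_eta P a b : eta_algebra (fun y => eta P (a * y + b))
| eta_algebraD f g : eta_algebra f -> eta_algebra g ->
    eta_algebra (fun y => f y + g y)
| eta_algebraM f g : eta_algebra f -> eta_algebra g ->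
    eta_algebra (fun y => f y * g y).

Lemma is_derive_affine (a b y : R) : is_derive y 1 (fun y => a * y + b) a.
Proof.
have := is_deriveD (is_deriveZ a (is_derive_id y (1 : R)))
  (is_derive_cst b y (1 : R)).
by rewrite -[_ *: _]/(_ * _) mulr1 addr0.
Qed.

Lemma is_derive_eta_affine P (a b y : R) :
  is_derive y 1 (fun y => eta P (a * y + b)) (eta (eta_deriv P) (a * y + b) * a).
Proof.
exact: (is_derive1_comp (f := eta P) (is_derive_eta _ _) (is_derive_affine a b y)).
Qed.

Lemma eta_algebra_deriv f : eta_algebra f ->
  exists2 g, eta_algebra g & forall y : R, is_derive y 1 f (g y).
Proof.
elim=> [c|P a b|g h _ [g' ag' dg] _ [h' ah' dh]|g h ag [g' ag' dg] ah [h' ah' dh]].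
- by exists (fun=> 0) => [|y]; [exact: eta_algebra_cst|exact: is_derive_cst].
- exists (fun y => eta (eta_deriv P) (a * y + b) * a) => [|y].
    by apply: eta_algebraM; [exact: eta_algebra_eta|exact: eta_algebra_cst].
  exact: is_derive_eta_affine.
- exists (fun y => g' y + h' y) => [|y]; first exact: eta_algebraD.
  exact: is_deriveD.
- exists (fun y => g y * h' y + h y * g' y) => [|y].
    by apply: eta_algebraD; exact: eta_algebraM.
  exact: is_deriveM.
Qed.

Lemma is_derive_continuous (f g : R -> R) :
  (forall y : R, is_derive y 1 f (g y)) -> continuous f.
Proof.
move=> fg y; apply: differentiable_continuous; apply/derivable1_diffP.
by case: (fg y).
Qed.

Lemma eta_algebra_continuous f : eta_algebra f -> continuous f.
Proof. by move=> /eta_algebra_deriv[g _]; exact: is_derive_continuous. Qed.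

Lemma eta_algebra_comp_affine f (a b : R) : eta_algebra f ->
  eta_algebra (fun y => f (a * y + b)).
Proof.
elim=> [c|P c d|g h _ IHg _ IHh|g h _ IHg _ IHh].
- exact: eta_algebra_cst.
- rewrite (_ : (fun _ => _) = fun y => eta P ((c * a) * y + (c * b + d))).
    exact: eta_algebra_eta.
  by apply/funext => y; rewrite mulrDr mulrA addrA.
- exact: eta_algebraD IHg IHh.
- exact: eta_algebraM IHg IHh.
Qed.

Lemma eta_algebra_sum (s : seq nat) (Q : pred nat) (f : nat -> R -> R) :
  (forall m, eta_algebra (f m)) -> eta_algebra (fun y => \sum_(m <- s | Q m) f m y).
Proof.
move=> af; elim: s => [|m s IHs].
  by under eq_fun do rewrite big_nil; exact: eta_algebra_cst.
under eq_fun do rewrite big_cons.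
case: (Q m) => //; exact: eta_algebraD.
Qed.

End eta_algebra.

Section tensor.
Context {R : realType} {n : nat}.
Implicit Types (h : 'I_n -> R -> R) (f : 'rV[R]_n -> R).

(** The product of the functions [h l] of the coordinates of [x]. *)
Definition tensor h (x : 'rV[R]_n) : R := \prod_(l < n) h l (x ord0 l).

Lemma is_derive_of_line f (k : 'I_n) (x : 'rV[R]_n) (d : R) :
  is_derive (0 : R) (1 : R) (fun t : R => f (x + t *: unit_vec k)) d ->
  is_derive x (unit_vec k) f d.
Proof.
set l := fun t : R => _ => -[dl vl].
have E : (fun t : R => t^-1 *: ((f \o shift x) (t *: unit_vec k) - f x)) =
    (fun t => t^-1 *: ((l \o shift 0) (t *: 1) - l 0)).
  apply/funext => t; rewrite /l/= /shift/= scale0r !addr0 scaler1.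
  by rewrite [_ + x]addrC.
by split; [rewrite /derivable E|rewrite /derive E].
Qed.

Lemma is_derive_tensor h k g : (forall y : R, is_derive y 1 (h k) (g y)) ->
  forall x, is_derive x (unit_vec k) (tensor h)
    (tensor (fun l => if l == k then g else h l) x).
Proof.
move=> hg x; apply: is_derive_of_line.
pose c := \prod_(l < n | l != k) h l (x ord0 l).
have -> : tensor (fun l => if l == k then g else h l) x = g (x ord0 k) * 1 * c.
  rewrite /tensor (bigD1 k)//= eqxx mulr1; congr (_ * _).
  by apply: eq_bigr => l /negbTE ->.
have -> : (fun t : R => tensor h (x + t *: unit_vec k)) =
    (fun t => h k (1 * t + x ord0 k) * c).
  apply/funext => t; rewrite /tensor (bigD1 k)//= !mxE !eqxx mulr1 addrC mul1r.
  congr (_ * _); apply: eq_bigr => l lk.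
  by rewrite !mxE (negbTE lk) andbF mulr0 addr0.
have dk : is_derive (0 : R) (1 : R)
    (fun t : R => h k (1 * t + x ord0 k)) (g (x ord0 k) * 1).
  apply: (is_derive1_comp (f := h k) _ (is_derive_affine 1 (x ord0 k) 0)).
  by rewrite mulr0 add0r; exact: hg.
have := is_deriveM dk (is_derive_cst c (0 : R) (1 : R)).
move=> /is_derive_eq; apply; rewrite -![_ *: _]/(_ * _) /=; ring.
Qed.

Lemma partial_tensor h k g : (forall y : R, is_derive y 1 (h k) (g y)) ->
  partial k (tensor h) = tensor (fun l => if l == k then g else h l).
Proof.
by move=> hg; apply/funext => x; case: (is_derive_tensor hg x).
Qed.

Lemma continuous_tensor h : (forall l, continuous (h l)) -> continuous (tensor h).
Proof.
move=> ch x; rewrite /tensor.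
apply: (@cvg_big _ _ _ _ _ (@mul_continuous R) _ (nbhs x)) => l _.
have cl : {for x, continuous (fun x : 'rV[R]_n => x ord0 l)}.
  exact: coord_continuous.
exact: (continuous_comp cl (ch l _)).
Qed.

(** The partial derivatives of such a product are products of the same kind. *)
Lemma smooth_tensor h : (forall l, eta_algebra (h l)) -> smooth (tensor h).
Proof.
move=> ah s.
have [g ag ->] : exists2 g, forall l, eta_algebra (g l) &
    foldr partial (tensor h) s = tensor g.
  elim: s => [|k s [g ag sg]]; first by exists h.
  have [g' ag' dg] := eta_algebra_deriv (ag k).
  exists (fun l => if l == k then g' else g l); first by move=> l; case: ifP.
  by rewrite /= sg (partial_tensor dg).
split=> [|k x].
  by apply: continuous_tensor => l; exact: eta_algebra_continuous.
have [g' ag' dg] := eta_algebra_deriv (ag k).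
by case: (is_derive_tensor dg x).
Qed.

End tensor.

(** * Smooth functions adapted to the Cantor sets *)

Section bump.
Context {R : realType}.

(** A smooth function with support in [-1, 2] that is at least [1] on [0, 1]. *)
Definition bump (y : R) : R :=
  expR 2 * (eta 1 (1 * y + 1) * eta 1 (-1 * y + 2)).

(** The derivative of [bump]. *)
Definition dbump (y : R) : R :=
  expR 2 * (eta 1 (1 * y + 1) * (eta (eta_deriv 1) (-1 * y + 2) * -1) +
            eta 1 (-1 * y + 2) * (eta (eta_deriv 1) (1 * y + 1) * 1)).

Lemma eta_algebra_bump : eta_algebra bump.
Proof.
apply: eta_algebraM; first exact: eta_algebra_cst.
by apply: eta_algebraM; exact: eta_algebra_eta.
Qed.

Lemma eta_algebra_dbump : eta_algebra dbump.
Proof.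
apply: eta_algebraM; first exact: eta_algebra_cst.
apply: eta_algebraD; apply: eta_algebraM; try exact: eta_algebra_eta;
  by apply: eta_algebraM; [exact: eta_algebra_eta|exact: eta_algebra_cst].
Qed.

Lemma is_derive_bump (y : R) : is_derive y 1 bump (dbump y).
Proof.
have d1 := is_derive_eta_affine (1 : {poly R}) 1 1 y.
have d2 := is_derive_eta_affine (1 : {poly R}) (-1) 2 y.
have := is_deriveM (is_derive_cst (expR 2 : R) y (1 : R)) (is_deriveM d1 d2).
by move=> /is_derive_eq; apply; rewrite -![_ *: _]/(_ * _) /dbump /=; ring.
Qed.

Lemma eta_ge0 (y : R) : 0 <= eta 1 y.
Proof. by rewrite /eta; case: ifP => // _; rewrite hornerC mul1r expR_ge0. Qed.

Lemma bump_ge0 y : 0 <= bump y.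
Proof. by rewrite !mulr_ge0 ?eta_ge0 ?expR_ge0. Qed.

Lemma bump_ge1 y : 0 <= y < 1 -> 1 <= bump y.
Proof.
move=> /andP[y0 y1].
have eta_ge z : 1 <= z -> expR (-1) <= eta 1 z :> R.
  move=> z1; have z0 : 0 < z by exact: lt_le_trans z1.
  by rewrite /eta z0 hornerC mul1r ler_expR lerN2 invf_le1.
have h1 : expR (-1) <= eta 1 (1 * y + 1) by apply: eta_ge; lra.
have h2 : expR (-1) <= eta 1 (-1 * y + 2) by apply: eta_ge; lra.
have := ler_pM (expR_ge0 _) (expR_ge0 _) h1 h2; rewrite -expRD => h.
rewrite /bump; apply: (@le_trans _ _ (expR 2 * expR (-1 + -1))).
  by rewrite -expRD (_ : 2 + _ = 0 :> R) ?expR0//; lra.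
by rewrite ler_wpM2l// expR_ge0.
Qed.

Lemma bump_support y : bump y != 0 -> -1 < y < 2.
Proof.
rewrite /bump /eta; case: ifP => [h1|]; last by rewrite mul0r mulr0 eqxx.
case: ifP => [h2 _|]; last by rewrite !mulr0 eqxx.
by apply/andP; split; lra.
Qed.

Lemma dbump_support y : dbump y != 0 -> -1 < y < 2.
Proof.
rewrite /dbump /eta; case: ifP => [h1|]; last first.
  by rewrite !mul0r !mulr0 addr0 mulr0 eqxx.
case: ifP => [h2 _|]; last by rewrite !mul0r !mulr0 addr0 mulr0 eqxx.
by apply/andP; split; lra.
Qed.

Lemma support_itv_bounded (phi : R -> R) : continuous phi ->
  (forall y, phi y != 0 -> -1 < y < 2) ->
  exists2 B : R, 0 < B & forall y, `|phi y| <= B.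
Proof.
move=> cphi sphi.
have : compact (phi @` `[-1, 2]%classic).
  apply: continuous_compact; first exact: continuous_subspaceT.
  exact: segment_compact.
move=> /compact_bounded[M [Mreal Mb]].
have B0 : 0 < Num.max M 0 + 1 by rewrite ltr_pwDr// le_max lexx orbT.
exists (Num.max M 0 + 1) => // y.
have [->|fy] := eqVneq (phi y) 0; first by rewrite normr0 ltW.
apply: Mb; first by rewrite ltr_pwDr// le_max lexx.
exists y => //; have /andP[y1 y2] := sphi _ fy.
by rewrite /= in_itv/= !ltW.
Qed.

Implicit Types (S : nat -> bool) (i : nat).

(** The sum of the copies of [phi] rescaled to the intervals of [cantor S i]. *)
Definition cantor_sum S i (phi : R -> R) (y : R) : R :=
  \sum_(0 <= m < 2 ^ i | cantor_code S i m) phi (2 ^+ i * y + - m%:R).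

(** The union of [cantor S i] and of its translates by [2 ^- i] and [- 2 ^- i]. *)
Definition cantor_nbhs S i : set R :=
  [set y | cantor S i y] `|`
  ([set y | cantor S i (y + 2 ^- i)] `|` [set y | cantor S i (y - 2 ^- i)]).

Lemma eta_algebra_cantor_sum S i phi :
  eta_algebra phi -> eta_algebra (cantor_sum S i phi).
Proof.
move=> aphi; apply: (@eta_algebra_sum _ _ _
  (fun m y => phi (2 ^+ i * y + - m%:R))) => m.
exact: eta_algebra_comp_affine.
Qed.

Lemma is_derive_cantor_sum S i (y : R) :
  is_derive y 1 (cantor_sum S i bump) (2 ^+ i * cantor_sum S i dbump y).
Proof.
rewrite /cantor_sum; elim: (index_iota _ _) => [|m s IHs].
  by under eq_fun do rewrite big_nil; rewrite big_nil mulr0; exact: is_derive_cst.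
under eq_fun do rewrite big_cons; rewrite big_cons; case: ifP => // _.
have db := is_derive1_comp (f := bump) (is_derive_bump _)
  (is_derive_affine (2 ^+ i) (- m%:R) y).
have := is_deriveD db IHs; move=> /is_derive_eq; apply.
by rewrite mulrDr [X in X + _]mulrC.
Qed.

Lemma cantor_sum_support S i (phi : R -> R) : (forall y, phi y != 0 -> -1 < y < 2) ->
  forall y, cantor_sum S i phi y != 0 -> cantor_nbhs S i y.
Proof.
move=> sphi y.
have [//|nT] := pselect (cantor_nbhs S i y).
have p2 : 0 < 2 ^+ i :> R by rewrite exprn_gt0.
have p2V : 2 ^+ i * 2 ^- i = 1 :> R by rewrite mulfV ?gt_eqF.
rewrite /cantor_sum big1 ?eqxx// => m cm; apply/eqP; apply: contra_notT nT.
move=> /sphi/andP[z1 z2].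
have mem x : m%:R <= 2 ^+ i * x < m%:R + 1 -> cantor S i x.
  rewrite natr1 => mx; split; last by rewrite (truncn_def mx).
  have /andP[+ _] := mx; move=> /(le_trans (ler0n _ m)).
  by rewrite pmulr_rge0.
have [ym|ym] := ltP (2 ^+ i * y) m%:R.
  by right; left; apply: mem; rewrite mulrDr p2V; apply/andP; split; lra.
have [ym'|ym'] := ltP (2 ^+ i * y) (m%:R + 1).
  by left; apply: mem; apply/andP; split; lra.
by right; right; apply: mem; rewrite mulrBr p2V; apply/andP; split; lra.
Qed.

(** At most three translates by integers of a function supported in [-1, 2] are
    nonzero at a given point. *)
Lemma count_window (t M : nat) :
  (\sum_(0 <= m < M) ((t <= m.+2) && (m <= t)) <= 3)%N.
Proof.
have one j : (\sum_(0 <= m < M) (m + j == t) <= 1)%N.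
  rewrite (_ : (\sum_(0 <= m < M) _)%N = ((j <= t) && (t < M + j))%N).
    by case: (_ && _).
  elim: M => [|M IHM]; first by rewrite big_nil add0n leqNgt andNb.
  rewrite big_nat_recr//= IHM addSn ltnS.
  by case: (ltngtP t (M + j)) => [tM|tM|->]; case: leqP => //=; lia.
apply: (@leq_trans (\sum_(0 <= m < M)
    ((m + 0 == t) + (m + 1 == t) + (m + 2 == t)))%N).
  apply: leq_sum => m _; rewrite addn0 addn1 addn2.
  by case: andP => // -[h1 h2]; lia.
by rewrite !big_split/= (leq_add (leq_add (one _) (one _)) (one _)).
Qed.

Lemma cantor_sum_bound S i (phi : R -> R) (B : R) :
  0 <= B -> (forall y, `|phi y| <= B) ->
  (forall y, phi y != 0 -> -1 < y < 2) ->
  forall y, `|cantor_sum S i phi y| <= 3 * B.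
Proof.
move=> B0 phiB sphi y; pose t := Num.truncn (2 ^+ i * y + 1).
apply: (le_trans (ler_norm_sum _ _ _)).
apply: (@le_trans _ _ (\sum_(0 <= m < 2 ^ i) ((t <= m.+2)%N && (m <= t)%N)%:R * B)).
  rewrite big_mkcond; apply: ler_sum => m _.
  case: ifP => _; last by rewrite mulr_ge0.
  have [->|/sphi/andP[z1 z2]] := eqVneq (phi (2 ^+ i * y + - m%:R)) 0.
    by rewrite normr0 mulr_ge0.
  have m0 : 0 <= m%:R :> R by [].
  have z0 : 0 <= 2 ^+ i * y + 1 by lra.
  have zm1 : m%:R <= 2 ^+ i * y + 1 by lra.
  have zm2 : 2 ^+ i * y + 1 < m.+3%:R by rewrite -addn3 natrD; lra.
  have -> : (m <= t)%N by rewrite /t truncn_ge_nat.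
  have -> : (t <= m.+2)%N.
    by rewrite -ltnS /t truncn_lt_nat.
  by rewrite mul1r.
rewrite -mulr_suml ler_wpM2r// -natr_sum ler_nat; exact: count_window.
Qed.

Lemma cantor_sum_ge1 S i y : cantor S i y -> 1 <= cantor_sum S i bump y.
Proof.
move=> [y0 cy]; set m := Num.truncn _ in cy.
have z0 : 0 <= 2 ^+ i * y by rewrite mulr_ge0// exprn_ge0.
have /andP[z1 z2] := truncn_itv z0.
have mI : m \in index_iota 0 (2 ^ i) by rewrite mem_index_iota (cantor_code_lt cy).
rewrite /cantor_sum big_mkcond (bigD1_seq m) ?iota_uniq//= cy.
rewrite -[leLHS]addr0; apply: lerD.
  by apply: bump_ge1; move: z1 z2; rewrite -natr1 => *; apply/andP; split; lra.
by apply: sumr_ge0 => l _; case: ifP => // _; exact: bump_ge0.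
Qed.

Lemma measurable_cantor_translate S i (c : R) :
  measurable [set y | cantor S i (y + c)].
Proof.
have := @measurable_funD _ _ R setT id (cst c) (@measurable_id _ _ _)
  (measurable_cst _) measurableT _ (measurable_cantor S i).
by rewrite setTI.
Qed.

Lemma measurable_cantor_nbhs S i : measurable (cantor_nbhs S i).
Proof.
apply: measurableU; first exact: measurable_cantor.
by apply: measurableU; exact: measurable_cantor_translate.
Qed.

Lemma lebesgue_measure_cantor_nbhs S i :
  (lebesgue_measure (cantor_nbhs S i) <= (3 * 2 ^- forced S i)%:E)%E.
Proof.
have mutr (c : R) :
    lebesgue_measure [set y | cantor S i (y + c)] = (2 ^- forced S i)%:E.
  rewrite lebesgue_measure_translation; last exact: measurable_cantor.
  exact: lebesgue_measure_cantor.
have E : (3 * 2 ^- forced S i)%:E = ((2 ^- forced S i)%:E +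
    ((2 ^- forced S i)%:E + (2 ^- forced S i)%:E) : \bar R)%E.
  by rewrite -!EFinD; congr EFin; lra.
pose T c : set R := [set y | cantor S i (y + c)].
have mT c : measurable (T c) by exact: measurable_cantor_translate.
have mU : measurable (T (2 ^- i) `|` T (- 2 ^- i)) by exact: measurableU.
have leU (A B : set R) : measurable A -> measurable B ->
    (lebesgue_measure (A `|` B) <= lebesgue_measure A + lebesgue_measure B)%E.
  by move=> mA mB; exact: measureU2.
rewrite E; apply: (le_trans (leU _ _ (measurable_cantor S i) mU)).
apply: leeD; first by rewrite lebesgue_measure_cantor.
by apply: (le_trans (leU _ _ (mT _) (mT _))); rewrite !mutr.
Qed.

End bump.

Section test_functions.
Context {R : realType} {n : nat}.
Implicit Types (F : 'rV[R]_n -> R).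

Lemma integral_powR_le (p c m : R) (T : set R) F : 0 < p -> 0 <= c ->
  measurable T -> (lebesgue_measure T <= m%:E)%E ->
  (forall x, `|F x| <= c) -> (forall x, F x != 0 -> cube T x) ->
  (\int[lebesgue_rV n]_x `|(F x)%:E| `^ p <= (c `^ p * m ^+ n)%:E)%E.
Proof.
move=> p0 c0 mT Tm Fc FT.
have mD : measurable (cube T : set 'rV[R]_n) by exact: measurable_box.
have T0 : (0 <= lebesgue_measure T)%E by exact: measure_ge0.
have Tfin : lebesgue_measure T = (fine (lebesgue_measure T))%:E.
  by rewrite fineK// ge0_fin_numE// (le_lt_trans Tm)// ltry.
apply: (@le_trans _ _ (\int[lebesgue_rV n]_(x in cube T) (c `^ p)%:E)%E).
  rewrite [leRHS]integral_mkcond; apply: ge0_le_integral_nomeas => [x _|x _].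
    exact: poweR_ge0.
  rewrite patchE; case: ifPn => [_|/negP xD].
    by rewrite lee_fin; apply: ge0_ler_powR; rewrite ?nnegrE// ltW.
  have [->|Fx] := eqVneq (F x) 0.
    by rewrite /= normr0 powR0// gt_eqF.
  by exfalso; apply: xD; rewrite inE; exact: FT.
rewrite integral_cst//.
have -> : (lebesgue_rV n : {measure set 'rV[R]_n -> \bar R}) (cube T) =
    (fine (lebesgue_measure T) ^+ n)%:E.
  have -> : fine (lebesgue_measure T) ^+ n =
      \prod_(i < n) fine (lebesgue_measure T) by rewrite prodr_const card_ord.
  exact: lebesgue_rV_boxE.
rewrite -EFinM lee_fin ler_wpM2l ?powR_ge0// lerXn2r ?nnegrE ?fine_ge0//.
  by rewrite -lee_fin; exact: le_trans Tm.
by rewrite -lee_fin -Tfin.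
Qed.

Lemma norm_tensor_le (h : 'I_n -> R -> R) (c : 'I_n -> R) :
  (forall l y, `|h l y| <= c l) -> forall x, `|tensor h x| <= \prod_(l < n) c l.
Proof.
move=> hc x; rewrite normr_prod; apply: ler_prod => l _.
by rewrite normr_ge0 hc.
Qed.

Lemma tensor_neq0 (h : 'I_n -> R -> R) x :
  tensor h x != 0 -> forall l, h l (x ord0 l) != 0.
Proof. by move=> /prodf_neq0 H l; exact: H. Qed.

(** The constant [A] depends neither on the constraints [S] nor on the rank. *)
Lemma cantor_test_function (p : R) : 0 < p ->
  exists2 A : R, 0 < A & forall (S : nat -> bool) (i : nat),
    exists f : 'rV[R]_n -> R,
    [/\ smooth f, compactly_supported f,
      forall x, cube (cantor S i) x -> 1 <= f x,
      (\int[lebesgue_rV n]_x `|(f x)%:E| `^ p <=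
         (A * (2 ^- forced S i) ^+ n)%:E)%E &
      forall k, (\int[lebesgue_rV n]_x `|(partial k f x)%:E| `^ p <=
         (A * (2 ^- forced S i) ^+ n * (2 ^+ i) `^ p)%:E)%E].
Proof.
move=> p0.
have [B1 B10 bB1] := support_itv_bounded
  (eta_algebra_continuous (@eta_algebra_bump R)) (@bump_support R).
have [B2 B20 bB2] := support_itv_bounded
  (eta_algebra_continuous (@eta_algebra_dbump R)) (@dbump_support R).
pose B := Num.max B1 B2.
have B0 : 0 < B by rewrite lt_max B10.
have bB y : `|bump y| <= B by rewrite le_max bB1.
have dB y : `|dbump y| <= B by rewrite le_max bB2 orbT.
pose c := (3 * B) ^+ n.
have c0 : 0 < c by rewrite exprn_gt0// mulr_gt0.
exists (c `^ p * 3 ^+ n); first by apply: mulr_gt0;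
  [exact: powR_gt0|exact: exprn_gt0].
move=> S i; pose g := cantor_sum S i (@bump R).
pose g' y := 2 ^+ i * cantor_sum S i (@dbump R) y.
have gg' (y : R) : is_derive y 1 g (g' y) by exact: is_derive_cantor_sum.
pose h (k : 'I_n) (l : 'I_n) := if l == k then g' else g.
pose f : 'rV[R]_n -> R := tensor (fun=> g).
have Df k : partial k f = tensor (h k) by exact: partial_tensor.
have gB y : `|g y| <= 3 * B.
  exact: cantor_sum_bound (ltW B0) bB (@bump_support R) y.
have p2 : 0 < 2 ^+ i :> R by rewrite exprn_gt0.
have g'B y : `|g' y| <= 2 ^+ i * (3 * B).
  rewrite normrM gtr0_norm// ler_wpM2l ?(ltW p2)//.
  exact: cantor_sum_bound (ltW B0) dB (@dbump_support R) y.
have gT y : g y != 0 -> cantor_nbhs S i y.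
  by apply: cantor_sum_support; exact: bump_support.
have g'T y : g' y != 0 -> cantor_nbhs S i y.
  rewrite mulf_eq0 negb_or => /andP[_].
  by apply: cantor_sum_support; exact: dbump_support.
have fT x : f x != 0 -> cube (cantor_nbhs S i) x.
  by move=> /tensor_neq0 fx l; exact: gT.
exists f; split.
- apply: smooth_tensor => _; apply: eta_algebra_cantor_sum.
  exact: eta_algebra_bump.
- pose K : set 'rV[R]_n := cube `[-1, 2]%classic.
  have cK : compact K.
    by apply: (@rV_compact R n (fun=> `[-1, 2]%classic)) => _;
      exact: segment_compact.
  have clK : closed K by exact: compact_closed (@norm_hausdorff _ _) cK.
  apply: (subclosed_compact _ cK); first exact: closed_closure.
  rewrite (iffLR (closure_id _) clK); apply: closureS => x /fT fx l.
  have r1 : 2 ^- i <= 1 :> R by rewrite invf_le1// exprn_ege1// ler1n.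
  have r0 : 0 < 2 ^- i :> R by rewrite invr_gt0.
  rewrite /= in_itv/=.
  by case: (fx l) => [|[]] /cantor_itv /andP[? ?]; apply/andP; split; lra.
- move=> x cx; have : \prod_(l < n) (1 : R) <= f x.
    apply: ler_prod => l _; rewrite ler01/=.
    by apply: cantor_sum_ge1; exact: cx.
  by rewrite big1_eq.
- rewrite -mulrA -exprMn; apply: integral_powR_le fT => //; first exact: ltW.
  + exact: measurable_cantor_nbhs.
  + exact: lebesgue_measure_cantor_nbhs.
  + move=> x; have := norm_tensor_le (fun (_ : 'I_n) y => gB y) x.
    by rewrite prodr_const card_ord.
- move=> k; have -> : c `^ p * 3 ^+ n * (2 ^- forced S i) ^+ n * (2 ^+ i) `^ p =
      (2 ^+ i * c) `^ p * (3 * 2 ^- forced S i) ^+ n.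
    by rewrite powRM ?(ltW c0) ?(ltW p2)// exprMn; ring.
  apply: (@integral_powR_le _ _ _ (cantor_nbhs S i)) => //.
  + by rewrite mulr_ge0 ?ltW.
  + exact: measurable_cantor_nbhs.
  + exact: lebesgue_measure_cantor_nbhs.
  + move=> x; rewrite Df.
    have hB l y : `|h k l y| <= (if l == k then 2 ^+ i else 1) * (3 * B).
      by rewrite /h; case: ifP => _; rewrite ?mul1r.
    apply: (le_trans (norm_tensor_le hB x)).
    by rewrite big_split/= prodr_const card_ord -big_mkcond/= big_pred1_eq.
  + move=> x; rewrite Df => /tensor_neq0 hx l; have := hx l.
    by rewrite /h; case: ifP => _; [exact: g'T|exact: gT].
Qed.

End test_functions.

(** * The Besov norm of a test function *)

Section power_integrals.
Context {R : realType}.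

Lemma integral_powR_itv (s a b : R) : s != 0 -> 0 < a -> a < b ->
  (\int[lebesgue_measure]_(t in `[a, b]) (t `^ (s - 1))%:E =
   (b `^ s / s)%:E - (a `^ s / s)%:E)%E.
Proof.
move=> s0 a0 ab.
have dF (x : R) : 0 < x ->
    is_derive x 1 (fun x : R => x `^ s / s) (x `^ (s - 1)).
  move=> x0; have := is_deriveM (is_derive1_powR s x0)
    (is_derive_cst (s^-1) x (1 : R)).
  move=> /is_derive_eq; apply; rewrite -![_ *: _]/(_ * _) /=.
  by rewrite mulr0 add0r mulrA mulVf// mul1r.
have cF (x : R) : 0 < x -> {for x, continuous (fun x : R => x `^ s / s)}.
  move=> x0; apply: differentiable_continuous; apply/derivable1_diffP.
  by case: (dF x x0).
apply: (continuous_FTC2 (F := fun x : R => x `^ s / s)) => //.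
- apply: continuous_in_subspaceT => x /[!inE]/= /[!in_itv]/= /andP[ax _].
  have x0 : 0 < x by exact: lt_le_trans ax.
  apply: differentiable_continuous; apply/derivable1_diffP.
  by case: (is_derive1_powR (s - 1) x0).
- split=> [x /[!in_itv]/= /andP[ax _]||].
  + by have /dF[] : 0 < x by exact: lt_trans ax.
  + by apply: cvg_at_right_filter; exact: cF.
  + by apply: cvg_at_left_filter; apply: cF; exact: lt_trans ab.
- move=> x /[!in_itv]/= /andP[ax _]; rewrite derive1E.
  by have /dF[] : 0 < x by exact: lt_trans ax.
Qed.

Lemma measurable_powR_EFin (D : set R) (s : R) :
  measurable_fun D (fun t : R => (t `^ s)%:E).
Proof.
by apply/measurable_EFinP; apply: measurable_funTS; exact: measurable_powR.
Qed.

(** An improper integral is bounded by the supremum of the proper ones. *)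
Lemma ge0_integral_bigcup_le (F : (set R)^nat) (phi : R -> \bar R) (c : \bar R) :
  nondecreasing_seq F -> (forall i, measurable (F i)) ->
  measurable_fun setT phi -> (forall x, 0 <= phi x)%E ->
  (forall i, (\int[lebesgue_measure]_(t in F i) phi t <= c)%E) ->
  (\int[lebesgue_measure]_(t in \bigcup_i F i) phi t <= c)%E.
Proof.
move=> ndF mF mphi phi0 Fc.
have H : ((\int[lebesgue_measure]_(t in F i) phi t) @[i --> \oo] -->
    \int[lebesgue_measure]_(t in \bigcup_i F i) phi t)%E.
  apply: ge0_nondecreasing_set_cvg_integral => //.
  by move=> i; exact: measurable_funTS.
rewrite -(cvg_lim _ H)//; apply: lime_le; first by apply/cvg_ex; eexists; exact: H.
by apply: nearW.
Qed.

Lemma integral_powR_near0 (s r : R) : 0 < s -> 0 < r ->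
  (\int[lebesgue_measure]_(t in `]0%R, r]) (t `^ (s - 1))%:E <= (r `^ s / s)%:E)%E.
Proof.
move=> s0 r0.
have -> : `]0, r]%classic = \bigcup_k `[r / k.+2%:R, r]%classic.
  apply/seteqP; split=> [x|x [k _]]; rewrite /= !in_itv/= => /andP[x0 xr].
    exists (Num.truncn (r / x)) => //=; rewrite in_itv/= xr andbT.
    rewrite ler_pdivrMr// mulrC -ler_pdivrMr//.
    by apply/ltW/(lt_le_trans (truncnS_gt _)); rewrite ler_nat.
  by rewrite xr andbT (lt_le_trans _ x0)// divr_gt0.
apply: ge0_integral_bigcup_le => //.
- apply/nondecreasing_seqP => k; rewrite subsetEset => x /=.
  rewrite !in_itv/= => /andP[x0 ->]; rewrite andbT; apply: le_trans x0.
  by rewrite ler_pM2l// lef_pV2 ?posrE// ler_nat.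
- exact: measurable_powR_EFin.
- by move=> x; rewrite lee_fin powR_ge0.
move=> k; rewrite integral_powR_itv ?gt_eqF ?divr_gt0//.
  by rewrite -EFinB lee_fin gerBl divr_ge0 ?powR_ge0// ltW.
by rewrite ltr_pdivrMr// ltr_pMr// ltr1n.
Qed.

Lemma integral_powR_infty (s r : R) : 0 < s -> 0 < r ->
  (\int[lebesgue_measure]_(t in `[r, +oo[) (t `^ (- s - 1))%:E <=
   (r `^ (- s) / s)%:E)%E.
Proof.
move=> s0 r0.
have -> : `[r, +oo[%classic = \bigcup_k `[r, r * k.+2%:R]%classic.
  apply/seteqP; split=> [x|x [k _]]; rewrite /= !in_itv/=.
    rewrite andbT => rx.
    exists (Num.truncn (x / r)) => //=; rewrite in_itv/= rx/=.
    rewrite mulrC -ler_pdivrMr//.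
    by apply/ltW/(lt_le_trans (truncnS_gt _)); rewrite ler_nat.
  by move=> /andP[->].
apply: ge0_integral_bigcup_le => //.
- apply/nondecreasing_seqP => k; rewrite subsetEset => x /=.
  rewrite !in_itv/= => /andP[-> /= x0]; apply: (le_trans x0).
  by rewrite ler_pM2l// ler_nat.
- exact: measurable_powR_EFin.
- by move=> x; rewrite lee_fin powR_ge0.
move=> k; rewrite integral_powR_itv ?oppr_eq0 ?gt_eqF//.
  rewrite -EFinB lee_fin !invrN !mulrN opprK addrC gerBl.
  by rewrite divr_ge0 ?powR_ge0// ltW.
by rewrite ltr_pMr// ltr1n.
Qed.

End power_integrals.

Section besov.
Context {R : realType} {n : nat}.
Variable p : R.
Hypothesis p1 : 1 < p.
Implicit Types (f : 'rV[R]_n -> R) (k : 'I_n).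

Let p0 : 0 < p. Proof. exact: lt_trans p1. Qed.

Lemma partial_modulus_ge0 k f t : 0 <= t -> (0 <= partial_modulus k p f t)%E.
Proof.
move=> t0; rewrite /partial_modulus; set A := [set _ | _ in _].
have A0 : A ('N[lebesgue_rV n]_p%:E[EFin \o
    (fun x => f (x + 0 *: unit_vec k) - f x)%R])%E.
  by exists 0 => //=; rewrite in_itv/= lexx.
exact: le_trans (Lnorm_ge0 _ _ _) (ereal_sup_ubound A0).
Qed.

Lemma partial_modulus_le_partial k f t : smooth f -> 0 <= t ->
  (partial_modulus k p f t <= t%:E * 'N[lebesgue_rV n]_p%:E[EFin \o partial k f])%E.
Proof.
move=> sf t0; apply: ge_ereal_sup => _ [h hI <-].
move: hI; rewrite /= in_itv/= => /andP[h0 ht].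
apply: (le_trans (Lnorm_diff_le p1 h0 _ _ _)).
- exact: smooth_continuous.
- by move=> y; exact: smooth_derivable.
- exact: smooth_partial_continuous.
by apply: lee_wpmul2r; [exact: Lnorm_ge0|rewrite lee_fin].
Qed.

Lemma partial_modulus_le_Lnorm k f t : continuous f ->
  (partial_modulus k p f t <= 2%:E * 'N[lebesgue_rV n]_p%:E[EFin \o f])%E.
Proof.
move=> cf; apply: ge_ereal_sup => _ [h _ <-].
have mf : measurable_fun setT f by exact: continuous_measurable_rV.
set e := h *: unit_vec k.
pose fe (x : 'rV[R]_n) := f (x + e).
have mfe : measurable_fun setT fe.
  exact: (measurableT_comp mf (measurable_translation_rV e)).
have mNf : measurable_fun setT (fun x => - f x) by exact: measurableT_comp.
have := @minkowski_EFin _ _ _ (lebesgue_rV n) fe (fun x => - f x) p mfe mNf (ltW p1).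
move=> /le_trans; apply.
have -> : ('N[lebesgue_rV n]_p%:E[EFin \o (fun x => - f x)%R] =
    'N[lebesgue_rV n]_p%:E[EFin \o f])%E.
  by rewrite -oppe_Lnorm; apply: eq_Lnorm => x /=; rewrite opprK.
have -> : ('N[lebesgue_rV n]_p%:E[EFin \o fe] =
    'N[lebesgue_rV n]_p%:E[EFin \o f])%E.
  rewrite unlock; apply: (congr1 (fun z => z `^ p^-1)%E).
  have mfp : measurable_fun setT (fun x => (`|f x| `^ p)%:E).
    apply/measurable_EFinP; apply: (measurableT_comp (@measurable_powR R p)).
    exact: measurableT_comp.
  have fp0 x : (0 <= (`|f x| `^ p)%:E)%E by rewrite lee_fin powR_ge0.
  exact: (ge0_integral_translation_rV e measurableT mfp fp0).
by rewrite (_ : 2 = 1 + 1 :> R)// EFinD ge0_muleDl ?lee_fin// !mul1e.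
Qed.

(** The modulus of continuity is at most [t] times the norm of the partial
    derivative, and at most twice the norm of [f]: use the first bound for
    [t <= r] and the second one for [t > r]. *)
Lemma besov_partial_norm_le alpha k f (a d r : R) :
  0 < alpha < 1 -> smooth f -> 0 < r -> 0 <= a -> 0 <= d ->
  (\int[lebesgue_rV n]_x `|(f x)%:E| `^ p <= a%:E)%E ->
  (\int[lebesgue_rV n]_x `|(partial k f x)%:E| `^ p <= d%:E)%E ->
  (besov_partial_norm alpha p p k f <=
   ((d * (r `^ (p * (1 - alpha)) / (p * (1 - alpha))) +
     2 `^ p * a * (r `^ (- (alpha * p)) / (alpha * p))) `^ p^-1)%:E)%E.
Proof.
move=> /andP[al0 al1] sf r0 a0 d0 fa fd.
have pN0 : p != 0 by rewrite gt_eqF.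
rewrite /besov_partial_norm -poweR_EFin; apply: le_poweR.
- by rewrite invr_ge0 ltW.
- apply: integral_ge0 => t; rewrite /= in_itv/= andbT => t0.
  by rewrite mule_ge0 ?poweR_ge0// lee_fin invr_ge0 ltW.
have mod1 t : 0 <= t -> (partial_modulus k p f t `^ p <= (t `^ p * d)%:E)%E.
  move=> t0; have h := le_poweR (ltW p0) (partial_modulus_ge0 k f t0)
    (partial_modulus_le_partial k sf t0).
  apply: (le_trans h); rewrite poweRM ?Lnorm_ge0 ?lee_fin//.
  rewrite poweR_Lnorm// poweR_EFin EFinM; apply: lee_wpmul2l;
    [by rewrite lee_fin powR_ge0|exact: fd].
have mod2 t : 0 <= t -> (partial_modulus k p f t `^ p <= (2 `^ p * a)%:E)%E.
  move=> t0; have h := le_poweR (ltW p0) (partial_modulus_ge0 k f t0)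
    (partial_modulus_le_Lnorm k t (smooth_continuous sf)).
  apply: (le_trans h); rewrite poweRM ?Lnorm_ge0 ?lee_fin//.
  rewrite poweR_Lnorm// poweR_EFin EFinM; apply: lee_wpmul2l;
    [by rewrite lee_fin powR_ge0|exact: fa].
pose s1 := p * (1 - alpha); pose s2 := alpha * p.
have s10 : 0 < s1 by rewrite mulr_gt0// subr_gt0.
have s20 : 0 < s2 by rewrite mulr_gt0.
pose D1 : set R := `]0, r]%classic; pose D2 : set R := `[r, +oo[%classic.
pose g1 (t : R) : \bar R := (d%:E * (t `^ (s1 - 1))%:E)%E.
pose g2 (t : R) : \bar R := ((2 `^ p * a)%:E * (t `^ (- s2 - 1))%:E)%E.
have mg1 : measurable_fun setT g1.
  by apply: emeasurable_funM => //; exact: measurable_powR_EFin.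
have mg2 : measurable_fun setT g2.
  by apply: emeasurable_funM => //; exact: measurable_powR_EFin.
have g10 t : (0 <= g1 t)%E by rewrite mule_ge0 ?lee_fin ?powR_ge0.
have g20 t : (0 <= g2 t)%E by rewrite mule_ge0 ?lee_fin ?mulr_ge0 ?powR_ge0.
have mI1 : measurable D1 by exact: measurable_itv.
have mI2 : measurable D2 by exact: measurable_itv.
have mP (D : set R) s : measurable_fun D (fun t : R => (t `^ s)%:E).
  exact: measurable_powR_EFin.
have I1 : (\int[lebesgue_measure]_(t in D1) g1 t <= (d * (r `^ s1 / s1))%:E)%E.
  have -> : (\int[lebesgue_measure]_(t in D1) g1 t =
      d%:E * \int[lebesgue_measure]_(t in D1) (t `^ (s1 - 1))%:E)%E.
    have mP1 := mP D1 (s1 - 1).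
    by apply: ge0_integralZl => // t _; rewrite lee_fin powR_ge0.
  by rewrite [leRHS]EFinM; apply: lee_wpmul2l => //; exact: integral_powR_near0.
have I2 : (\int[lebesgue_measure]_(t in D2) g2 t <=
    (2 `^ p * a * (r `^ (- s2) / s2))%:E)%E.
  have c0 : (0 <= (2 `^ p * a)%:E)%E by rewrite lee_fin mulr_ge0 ?powR_ge0.
  have -> : (\int[lebesgue_measure]_(t in D2) g2 t =
      (2 `^ p * a)%:E * \int[lebesgue_measure]_(t in D2) (t `^ (- s2 - 1))%:E)%E.
    have mP2 := mP D2 (- s2 - 1).
    by apply: ge0_integralZl => // t _; rewrite lee_fin powR_ge0.
  by rewrite [leRHS]EFinM; apply: lee_wpmul2l => //; exact: integral_powR_infty.
have mD1 : measurable_fun setT (g1 \_ D1).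
  by apply: (measurable_restrictT _ mI1).1; exact: measurable_funTS.
have mD2 : measurable_fun setT (g2 \_ D2).
  by apply: (measurable_restrictT _ mI2).1; exact: measurable_funTS.
have gD1 t : (0 <= (g1 \_ D1) t)%E by exact: erestrict_ge0.
have gD2 t : (0 <= (g2 \_ D2) t)%E by exact: erestrict_ge0.
rewrite EFinD; apply: le_trans (leeD I1 I2).
rewrite [leLHS]integral_mkcond [in X in (_ <= X + _)%E]integral_mkcond.
rewrite [in X in (_ <= _ + X)%E]integral_mkcond.
rewrite -ge0_integralD//.
apply: ge0_le_integral_nomeas => t _.
  apply: erestrict_ge0 => {}t; rewrite /= in_itv/= andbT => t0.
  by rewrite mule_ge0 ?poweR_ge0// lee_fin invr_ge0 ltW.
rewrite [leLHS]patchE; case: ifPn => [|_]; last by rewrite adde_ge0.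
rewrite inE/= in_itv/= andbT => t0.
have tV0 : (0 <= t^-1%:E)%E by rewrite lee_fin invr_ge0 ltW.
have t0' := ltW t0.
rewrite poweRM ?lee_fin ?powR_ge0 ?partial_modulus_ge0// poweR_EFin.
rewrite -powRrM.
have [tr|tr] := leP t r.
  apply: (@le_trans _ _ (g1 t)); last first.
    have -> : (g1 \_ D1) t = g1 t.
      have D1t : D1 t by rewrite /D1/= in_itv/= t0.
      by rewrite patchE mem_set.
    by rewrite -[leLHS]adde0 leeD2l.
  apply: (@le_trans _ _ ((t `^ (- alpha * p))%:E * (t `^ p * d)%:E * t^-1%:E)%E).
    apply: lee_wpmul2r => //; apply: lee_wpmul2l; first by rewrite lee_fin powR_ge0.
    by apply: mod1; exact: ltW.
  rewrite /g1 -!EFinM lee_fin le_eqVlt; apply/orP; left; apply/eqP.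
  rewrite -(powR_inv1 (ltW t0)) mulrA -powRD; last by rewrite (gt_eqF t0) implybT.
  rewrite mulrAC -powRD; last by rewrite (gt_eqF t0) implybT.
  by rewrite mulrC; congr (_ * _ `^ _); rewrite /s1; ring.
apply: (@le_trans _ _ (g2 t)); last first.
  have -> : (g2 \_ D2) t = g2 t.
    have D2t : D2 t by rewrite /D2/= in_itv/= andbT ltW.
    by rewrite patchE mem_set.
  by rewrite -[leLHS]add0e leeD2r.
apply: (@le_trans _ _ ((t `^ (- alpha * p))%:E * (2 `^ p * a)%:E * t^-1%:E)%E).
  apply: lee_wpmul2r => //; apply: lee_wpmul2l; first by rewrite lee_fin powR_ge0.
  by apply: mod2; exact: ltW.
rewrite /g2 -!EFinM lee_fin le_eqVlt; apply/orP; left; apply/eqP.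
rewrite -(powR_inv1 (ltW t0)) mulrAC -powRD; last by rewrite (gt_eqF t0) implybT.
by rewrite mulrC; congr (_ * _ `^ _); rewrite /s2; ring.
Qed.

End besov.

(** * Vanishing of the Besov capacities *)

Section vanishing.
Context {R : realType} {n : nat}.
Variable p : R.
Hypothesis p1 : 1 < p.
Hypothesis pn : p < n%:R.

Let p0 : 0 < p. Proof. exact: lt_trans p1. Qed.
Let rho : R := @ratio R n p.
Let S := greedy rho.
Let E : set 'rV[R]_n := @cantor_set R n p.

Lemma quadratic_expR_lt (lambda eps : R) : 0 < lambda -> 0 < eps ->
  exists i : nat, (i.+1 * i.+2)%:R * expR (- (lambda * i%:R)) <= eps.
Proof.
move=> l0 e0; pose M := 36 / (lambda ^+ 3 * eps).
have le0 : 0 < lambda ^+ 3 * eps by rewrite mulr_gt0// exprn_gt0.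
(* [36] is the product of [3!] and of the [6] in [hq]. *)
exists (Num.truncn M).+1; set i := (Num.truncn M).+1.
have Mi : M < i%:R by exact: truncnS_gt.
have i1 : 1 <= i%:R :> R by rewrite ler1n.
have li0 : 0 <= lambda * i%:R by rewrite mulr_ge0 ?ltW.
rewrite expRN ler_pdivrMr ?expR_gt0//.
have h := expR_ge1Dxn 2 li0.
have h6 : (lambda * i%:R) ^+ 3 / 6 <= expR (lambda * i%:R).
  by apply: le_trans h; rewrite lerDr.
have hq : (i.+1 * i.+2)%:R <= 6 * i%:R ^+ 2 :> R.
  have [E1 E2] : i.+1%:R = i%:R + 1 :> R /\ i.+2%:R = i%:R + 2 :> R.
    by split; rewrite ?natr1// -natrD addn2.
  by rewrite natrM E1 E2; move: i1; generalize (i%:R : R) => x x1; nra.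
apply: (le_trans hq); apply: (@le_trans _ _ (eps * ((lambda * i%:R) ^+ 3 / 6))).
  move: Mi; rewrite /M ltr_pdivrMr// => Mi.
  have i2 : 0 < i%:R ^+ 2 :> R by rewrite exprn_gt0// (lt_le_trans _ i1).
  have -> : eps * ((lambda * i%:R) ^+ 3 / 6) =
    i%:R ^+ 2 * (i%:R * (lambda ^+ 3 * eps) / 6) by field.
  by rewrite mulrC ler_pM2l//; lra.
by rewrite ler_wpM2l// ltW.
Qed.

(** The left-hand side is the order of magnitude of the Besov norm, to the power
    [p], of the test function of rank [i]; the right-hand side tends to [0] if
    [alpha < 1]. *)
Lemma cantor_volume_le (alpha : R) (i : nat) :
  (2 ^- forced S i) ^+ n * (2 ^+ i) `^ (alpha * p) <=
  (rho * (i.+1 * i.+2)%:R * (2 ^+ i) `^ (alpha - 1)) `^ p.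
Proof.
have r0 : 0 < rho by exact: lt_trans (ratio_gt2 p1 pn).
have p2 : 0 < 2 ^+ i :> R by rewrite exprn_gt0.
set b := forced S i.
have -> : (2 ^- b) ^+ n = (rho ^- b) `^ p.
  have := @powR_ratio R n p b => <-; rewrite -powRN opprK.
  by rewrite -powRrM divfK ?gt_eqF// powR_mulrn// invr_ge0 exprn_ge0.
have rb0 : 0 <= rho ^- b by rewrite invr_ge0 exprn_ge0// ltW.
rewrite (powRrM (2 ^+ i)) -(powRM _ rb0 (powR_ge0 _ _)).
apply: ge0_ler_powR; rewrite ?nnegrE; first exact: ltW.
- by rewrite mulr_ge0// powR_ge0.
- by rewrite !mulr_ge0 ?powR_ge0 ?(ltW r0).
have -> : (2 ^+ i) `^ (alpha - 1) = (2 ^+ i) `^ alpha / 2 ^+ i.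
  rewrite powRB; last by rewrite (gt_eqF p2) implybT.
  by rewrite powRr1// ltW.
have hb : rho ^- b <= rho * (i.+1 * i.+2)%:R / 2 ^+ i.
  rewrite ler_pdivlMr// mulrC ler_pdivrMr ?exprn_gt0//.
  have := greedy_ge i (ratio_gt2 p1 pn); rewrite -/rho -/S -/b exprS.
  by rewrite -!mulrA [in X in _ -> X](mulrC (_%:R)).
rewrite (_ : _ * (_ / _) = rho * (i.+1 * i.+2)%:R / 2 ^+ i * (2 ^+ i) `^ alpha).
  by apply: ler_wpM2r => //; exact: powR_ge0.
by rewrite mulrA [RHS]mulrAC.
Qed.

(** The test function of rank [i], with the scale [2 ^- i] as the value of [r] in
    the estimate of its Besov norm. *)
Lemma cap_besov_le (alpha : R) : 0 < alpha < 1 ->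
  exists2 C : R, 0 < C & forall i : nat, (cap_besov alpha p p E <=
    (C * ((2 ^- forced S i) ^+ n * (2 ^+ i) `^ (alpha * p)))%:E)%E.
Proof.
move=> al; have /andP[al0 al1] := al.
have [A A0 test] := @cantor_test_function R n p p0.
pose K := (p * (1 - alpha))^-1 + 2 `^ p * (alpha * p)^-1.
have s10 : 0 < p * (1 - alpha) by rewrite mulr_gt0// subr_gt0.
have s20 : 0 < alpha * p by rewrite mulr_gt0.
have n0 : 0 < n%:R :> R by exact: lt_trans pn.
have K0 : 0 < K.
  by rewrite addr_gt0 ?invr_gt0// mulr_gt0 ?powR_gt0 ?invr_gt0.
exists (n%:R `^ p * A * K); first by rewrite !mulr_gt0 ?powR_gt0.
move=> i; have [f [sf cf f1 fa fd]] := test S i.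
set v := (2 ^- forced S i) ^+ n in fa fd *.
have v0 : 0 <= v by rewrite exprn_ge0// invr_ge0 exprn_ge0.
have p2 : 0 < 2 ^+ i :> R by rewrite exprn_gt0.
have adm : admissible E f.
  split=> // x Ex.
  have cl : closed [set y | 1 <= f y].
    have -> : [set y | 1 <= f y] = f @^-1` `[1, +oo[%classic.
      by apply/seteqP; split=> y; rewrite /= in_itv/= andbT.
    apply: closed_comp => [y _|]; first exact: smooth_continuous.
    exact: interval_closed.
  have : closure [set y | 1 <= f y] x.
    by move: x Ex; apply: closureS => y cy; apply: f1 => l; exact: cy.
  by rewrite -(iffLR (closure_id _) cl).
apply: (@le_trans _ _ (besov_norm alpha p p f `^ p)%E).
  by apply: ereal_inf_lbound; exists f.
pose c := A * v * ((2 ^+ i) `^ (alpha * p) * K).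
have c0 : 0 <= c by rewrite !mulr_ge0 ?powR_ge0 ?(ltW A0) ?(ltW K0).
have bk k : (besov_partial_norm alpha p p k f <= (c `^ p^-1)%:E)%E.
  have r0 : 0 < 2 ^- i :> R by rewrite invr_gt0.
  have := besov_partial_norm_le p1 al sf r0 _ _ fa (fd k).
  rewrite !mulr_ge0 ?powR_ge0 ?(ltW A0)// => /(_ erefl erefl) /le_trans; apply.
  rewrite le_eqVlt; apply/orP; left; apply/eqP; congr (_ `^ _)%:E.
  have powV (s : R) : ((2 ^+ i)^-1 : R) `^ (- s) = (2 ^+ i) `^ s.
    have := powR_inv1 (ltW p2); move=> <-.
    by rewrite -powRrM mulrNN mul1r.
  have -> : p * (1 - alpha) = - (alpha * p - p) by ring.
  rewrite !powV powRB; last by rewrite (gt_eqF p2) implybT.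
  rewrite /c /K; field.
  have sE : alpha * p - p = - (p * (1 - alpha)) by ring.
  rewrite sE oppr_eq0 !mulf_neq0 ?gt_eqF ?powR_gt0 ?subr_gt0//.
have B0 : (0 <= besov_norm alpha p p f)%E.
  by apply: sume_ge0 => k _; exact: poweR_ge0.
have Ble : (besov_norm alpha p p f <= (n%:R * c `^ p^-1)%:E)%E.
  apply: (le_trans (lee_sum _ (fun k _ => bk k))).
  by rewrite sumEFin sumr_const card_ord mulr_natl.
apply: (le_trans (le_poweR (ltW p0) B0 Ble)).
rewrite poweR_EFin lee_fin powRM ?powR_ge0 ?(ltW n0)//.
rewrite -powRrM mulVf ?gt_eqF// powRr1// /c le_eqVlt; apply/orP; left.
by apply/eqP; ring.
Qed.

Lemma cap_besov_eq0 (alpha : R) : 0 < alpha < 1 -> cap_besov alpha p p E = 0%E.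
Proof.
move=> al; have /andP[al0 al1] := al.
have [C C0 capC] := cap_besov_le al.
have r0 : 0 < rho by exact: lt_trans (ratio_gt2 p1 pn).
apply/eqP; rewrite eq_le; apply/andP; split; last first.
  by apply: le_ereal_inf_tmp => _ [f _ <-]; exact: poweR_ge0.
apply/lee_addgt0Pr => e e0; rewrite add0e.
pose delta := (e / C) `^ p^-1.
have d0 : 0 < delta by rewrite powR_gt0// divr_gt0.
have l0 : 0 < (1 - alpha) * ln 2 by rewrite mulr_gt0 ?subr_gt0// ln_gt0// ltr1n.
have [i hi] := quadratic_expR_lt l0 (divr_gt0 d0 r0).
apply: (le_trans (capC i)); rewrite lee_fin mulrC -ler_pdivlMr//.
apply: (le_trans (cantor_volume_le _ _)).
have -> : e / C = delta `^ p.
  by rewrite /delta -powRrM mulVf ?gt_eqF// powRr1// divr_ge0 ?ltW.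
apply: ge0_ler_powR; rewrite ?nnegrE; first exact: ltW.
- by rewrite !mulr_ge0 ?powR_ge0 ?(ltW r0).
- exact: ltW.
rewrite -mulrA mulrC -ler_pdivlMr//; apply: le_trans hi.
rewrite ler_wpM2l// le_eqVlt; apply/orP; left; apply/eqP.
rewrite /powR gt_eqF ?exprn_gt0// lnXn//; congr expR.
by rewrite -mulr_natr; ring.
Qed.

Lemma cap_sobolev_gt0 : (0 < cap_sobolev p E)%E.
Proof.
have r2 := ratio_gt2 p1 pn; have r0 : 0 < rho by exact: lt_trans r2.
pose K := (1 - 2 / rho)^-1 + 1.
have K0 : 0 < K.
  by rewrite addr_gt0// invr_gt0 subr_gt0 ltr_pdivrMr// mul1r.
apply: (@lt_le_trans _ _ ((K^-1 / 4) `^ p)%:E).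
  by rewrite lte_fin powR_gt0// divr_gt0// invr_gt0.
apply: le_ereal_inf_tmp => _ [f admf <-]; rewrite -poweR_EFin.
apply: le_poweR; [exact: ltW|by rewrite lee_fin divr_ge0// invr_ge0 ltW|].
have := gradient_norm_ge p1 pn admf; rewrite -/rho -/K => h.
by rewrite EFinM lee_pdivrMl.
Qed.

End vanishing.

Theorem mainTheorem3 (R : realType) (n : nat) (p : R)
    (n_ge2 : (2 <= n)%N) (p_gt1 : 1 < p) (p_ltn : p < n%:R) :
  exists E : set 'rV[R]_n,
    [/\ compact E,
        (0 < cap_sobolev p E)%E,
        forall alpha : R, 0 < alpha < 1 -> cap_besov alpha p p E = 0%E
      & forall q : R, q = p ->
        ~ ((((1 - alpha) `^ (p / q))%:E * cap_besov alpha p q E)%E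
             @[alpha --> 1^'-]
           --> (((1 / q) `^ (p / q))%:E * cap_sobolev p E)%E)].
Proof.
have sobolev0 := cap_sobolev_gt0 p_gt1 p_ltn.
have besov0 := cap_besov_eq0 p_gt1 p_ltn.
exists (@cantor_set R n p); split => //; first exact: compact_cantor_set.
move=> q -> H.
have p0 : 0 < p by exact: lt_trans p_gt1.
have /cvg_unique/(_ H) : (((1 - alpha) `^ (p / p))%:E *
    cap_besov alpha p p (@cantor_set R n p))%E @[alpha --> 1^'-] --> 0%E.
  apply: cvg_near_cst; near=> alpha; rewrite besov0 ?mule0//.
  by apply/andP; split; near: alpha; [exact: nbhs_left_gt|exact: nbhs_left_lt].
move=> /(_ (@ereal_hausdorff R)) /esym/eqP; apply/negP.
by rewrite gt_eqF// mule_gt0// lte_fin powR_gt0// divr_gt0.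
Unshelve. all: by end_near. Qed.
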